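(* Let $\mathcal{A}$ be a unital $C^*$-algebra, let $\mathcal{S}$ and $\mathcal{T}$ be two faithful operator $\mathcal{A}$-systems with units $e_{\mathcal{S}}$ and $e_{\mathcal{T}}$, and let $$\mathcal{J}:=\{\,(a\cdot e_{\mathcal{S}})\oplus(-a\cdot e_{\mathcal{T}}) : a\in\mathcal{A}\,\}\subseteq \mathcal{S}\oplus\mathcal{T}.$$ Then there is an operator $\mathcal{A}$-system structure on the quotient operator system $(\mathcal{S}\oplus\mathcal{T})/\mathcal{J}$ and, up to a complete order isomorphism, $$(\mathcal{S}\oplus\mathcal{T})/\mathcal{J}\;\cong\;\mathcal{S}\oplus_{\mathcal{A}}\mathcal{T}.$$ Moreover, the quotient map $q:\mathcal{S}\oplus\mathcal{T}\to(\mathcal{S}\oplus\mathcal{T})/\mathcal{J}$ is a unital completely positive $\mathcal{A}$-bimodule map.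
   Context: An operator system is a triple $(\mathcal{S},\{M_n(\mathcal{S})^+\}_{n},e)$ consisting of a matrix ordered $*$-vector space with an Archimedean matrix order unit $e$. ''Ucp'' means unital completely positive. An operator system $\mathcal{S}$ is an operator $\mathcal{A}$-system if it is a (unital) $\mathcal{A}$-bimodule such that $(a\cdot s)^*=s^*\cdot a^*$, $a\cdot e=e\cdot a$, and $[a_{ij}]\cdot[s_{ij}]\cdot[a_{ij}]^*\in M_n(\mathcal{S})^+$ for all $a\in\mathcal{A}$, $s\in\mathcal{S}$, $[a_{ij}]\in M_{n,m}(\mathcal{A})$, $[s_{ij}]\in M_m(\mathcal{S})^+$. It is faithful if $a\cdot e\neq0$ for all $a\in\mathcal{A}\setminus\{0\}$; then $\mathcal{A}$ is identified with $\mathcal{A}\cdot e\subseteq\mathcal{S}$. A linear map $\phi$ between operator $\mathcal{A}$-systems is an $\mathcal{A}$-bimodule map if $\phi(a_1\cdot s\cdot a_2)=a_1\cdot\phi(s)\cdot a_2$. Coproduct: for faithful operator $\mathcal{A}$-systems $\mathcal{S},\mathcal{T}$, the coproduct $\mathcal{S}\oplus_{\mathcal{A}}\mathcal{T}$ is the unique faithful operator $\mathcal{A}$-system, together with unital complete order embeddings $\mathcal{S}\hookrightarrow\mathcal{S}\oplus_{\mathcal{A}}\mathcal{T}$ and $\mathcal{T}\hookrightarrow\mathcal{S}\oplus_{\mathcal{A}}\mathcal{T}$ that are $\mathcal{A}$-bimodule maps, such that for every operator $\mathcal{A}$-system $\mathcal{R}$ and ucp $\mathcal{A}$-bimodule maps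 $\psi_1:\mathcal{S}\to\mathcal{R}$, $\psi_2:\mathcal{T}\to\mathcal{R}$ there is a unique ucp $\mathcal{A}$-bimodule map $\Psi:\mathcal{S}\oplus_{\mathcal{A}}\mathcal{T}\to\mathcal{R}$ extending $\psi_1$ and $\psi_2$ along the embeddings. $\mathcal{S}\oplus\mathcal{T}$ is the direct sum operator system with unit $e_{\mathcal{S}}\oplus e_{\mathcal{T}}$, cones $M_n(\mathcal{S})^+\oplus M_n(\mathcal{T})^+$, and componentwise $\mathcal{A}$-action. Quotients: a subspace $\mathcal{J}$ of an operator system $\mathcal{U}$ (with unit $e$) is a kernel if it is the kernel of some ucp map from $\mathcal{U}$ into an operator system. For a kernel $\mathcal{J}$ put $D_n=\{[u_{ij}+\mathcal{J}]\in M_n(\mathcal{U}/\mathcal{J}) : \exists\,k_{ij}\in\mathcal{J},\ [u_{ij}]+[k_{ij}]\in M_n(\mathcal{U})^+\}$ and $C_n=\{[u_{ij}+\mathcal{J}] : \forall\varepsilon>0,\ \varepsilon(e\otimes I_n)+[u_{ij}]+M_n(\mathcal{J})\in D_n\}$. The quotient operator system is $(\mathcal{U}/\mathcal{J},\{C_n\}_n,e+\mathcal{J})$. (The statement includes that $\mathcal{J}$ is a kernel, so that this quotient is defined.) *)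

(* Defs.v *)
From HB Require Import structures.
From mathcomp Require Import all_boot all_order all_algebra.
From mathcomp Require Import generic_quotient ring_quotient complex.
From mathcomp Require Import boolp classical_sets reals.

Set Implicit Arguments.
Unset Strict Implicit.
Unset Printing Implicit Defensive.

Import Order.TTheory GRing.Theory Num.Theory.

Local Open Scope classical_set_scope.
Local Open Scope ring_scope.
Local Open Scope quotient_scope.

(* The library hierarchy has no join of the ring and normed-space structures
   below numDomainType, so the C*-norm is a separate real-valued field.
   algType includes 1 != 0. *)
HB.mixin Record isCStarAlgebra (R : realType) A of GRing.Algebra R[i] A := {
  cnorm : A -> R;
  cstar : A -> A;
  cnorm_eq0 : forall x : A, cnorm x = 0 -> x = 0;
  cnormD : forall x y : A, cnorm (x + y) <= cnorm x + cnorm y;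
  cnormZ : forall (c : R[i]) (x : A), (cnorm (c *: x))%:C%C = `|c| * (cnorm x)%:C%C;
  cnormM : forall x y : A, cnorm (x * y) <= cnorm x * cnorm y;
  cnorm_complete : forall u : nat -> A,
    (forall e : R, 0 < e -> exists N : nat, forall m n : nat,
      (N <= m)%N -> (N <= n)%N -> cnorm (u m - u n) < e) ->
    exists l : A, forall e : R, 0 < e -> exists N : nat, forall n : nat,
      (N <= n)%N -> cnorm (u n - l) < e;
  cstarK : involutive cstar;
  cstar_semilinear : forall (c : R[i]) (x y : A),
    cstar (c *: x + y) = c^* *: cstar x + cstar y;
  cstarM : forall x y : A, cstar (x * y) = cstar y * cstar x;
  cstar_identity : forall x : A, cnorm (cstar x * x) = cnorm x ^+ 2
}.

#[short(type="cstarAlgType")]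
HB.structure Definition CStarAlgebra (R : realType) :=
  {A of GRing.Algebra R[i] A & isCStarAlgebra R A}.

Section MatrixLevels.
Variables (R : realType) (V : lmodType R[i]).

Definition mxstar (st : V -> V) m n (X : 'M[V]_(m, n)) : 'M[V]_(n, m) :=
  \matrix_(i, j) st (X j i).

Definition mxscale (c : R[i]) m n (X : 'M[V]_(m, n)) : 'M[V]_(m, n) :=
  \matrix_(i, j) (c *: X i j).

(* e (x) I_n *)
Definition mxunit (e : V) n : 'M[V]_n := \matrix_(i, j) (e *+ (i == j)).

(* al^* X al *)
Definition mxcompress n m (al : 'M[R[i]]_(n, m)) (X : 'M[V]_n) : 'M[V]_m :=
  \matrix_(i, j) \sum_k \sum_l ((al k i)^* * al l j) *: X k l.

End MatrixLevels.

(* The order of R[i] is partial: 0 <= t and 0 < t entail that t is real.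
   Level n = 0 is allowed throughout; 'M[V]_0 is a singleton, so it is
   vacuous. *)
HB.mixin Record isOperatorSystem (R : realType) V of GRing.Lmodule R[i] V := {
  star : V -> V;
  pos : forall n, set 'M[V]_n;
  opunit : V;
  starK : involutive star;
  star_semilinear : forall (c : R[i]) (x y : V),
    star (c *: x + y) = c^* *: star x + star y;
  pos_herm : forall n (X : 'M[V]_n), pos n X -> mxstar star X = X;
  pos0 : forall n, pos n 0;
  posD : forall n (X Y : 'M[V]_n), pos n X -> pos n Y -> pos n (X + Y);
  posZ : forall n (t : R[i]) (X : 'M[V]_n),
    0 <= t -> pos n X -> pos n (mxscale t X);
  pos_proper : forall n (X : 'M[V]_n), pos n X -> pos n (- X) -> X = 0;
  pos_compress : forall n m (al : 'M[R[i]]_(n, m)) (X : 'M[V]_n),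
    pos n X -> pos m (mxcompress al X);
  star_opunit : star opunit = opunit;
  order_unit : forall n (X : 'M[V]_n), mxstar star X = X ->
    exists2 r : R[i], 0 < r & pos n (mxscale r (mxunit opunit n) + X);
  archimedean : forall n (X : 'M[V]_n),
    (forall r : R[i], 0 < r -> pos n (mxscale r (mxunit opunit n) + X)) ->
    pos n X
}.

#[short(type="operatorSystemType")]
HB.structure Definition OperatorSystem (R : realType) :=
  {V of GRing.Lmodule R[i] V & isOperatorSystem R V}.

Arguments pos {R s n} _.
Arguments opunit {R s}.
Arguments pos_herm {R s n} [X] _.
Arguments posD {R s n} [X Y] _ _.
Arguments posZ {R s n} [t X] _ _.
Arguments pos_proper {R s n} [X] _ _.
Arguments pos_compress {R s n m} al [X] _.
Arguments order_unit {R s n} [X] _.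
Arguments archimedean {R s n} [X] _.

Section Maps.
Variable R : realType.

Definition completely_positive (S T : operatorSystemType R)
    (f : {linear S -> T}) :=
  forall n (X : 'M[S]_n), pos X -> pos (map_mx f X).

Definition unital (S T : operatorSystemType R) (f : {linear S -> T}) :=
  f opunit = opunit.

Definition ucp (S T : operatorSystemType R) (f : {linear S -> T}) :=
  unital f /\ completely_positive f.

Definition complete_order_embedding (S T : operatorSystemType R)
    (f : {linear S -> T}) :=
  injective f /\ forall n (X : 'M[S]_n), pos X <-> pos (map_mx f X).

Definition complete_order_iso (S T : operatorSystemType R)
    (f : {linear S -> T}) :=
  completely_positive f /\
  exists g : {linear T -> S},
    [/\ completely_positive g, cancel f g & cancel g f].

End Maps.

Section OperatorSystemTheory.
Variables (R : realType) (V : operatorSystemType R).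

Fact star0 : star (0 : V) = 0.
Proof.
have := star_semilinear (-1 : R[i]) (0 : V) 0.
by rewrite scaler0 addr0 rmorphN1 scaleN1r addNr.
Qed.

Fact starD (x y : V) : star (x + y) = star x + star y.
Proof. by have := star_semilinear 1 x y; rewrite rmorph1 !scale1r. Qed.

Fact starZ (c : R[i]) (x : V) : star (c *: x) = c^* *: star x.
Proof. by have := star_semilinear c x 0; rewrite !addr0 star0 addr0. Qed.

Fact starN (x : V) : star (- x) = - star x.
Proof. by rewrite -scaleN1r starZ rmorphN1 scaleN1r. Qed.

Fact pos_mxunit n : pos (mxunit (opunit : V) n).
Proof.
have [|r r0 +] := @order_unit _ V n 0.
  by apply/matrixP=> i j; rewrite !mxE star0.
rewrite addr0 => /(@posZ _ V n r^-1); rewrite invr_ge0 (ltW r0) => /(_ isT).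
suff -> : mxscale r^-1 (mxscale r (mxunit (opunit : V) n)) = mxunit opunit n by [].
by apply/matrixP=> i j; rewrite !mxE scalerA mulVf ?scale1r // gt_eqF.
Qed.

Fact pos_unit_ge n (r s : R[i]) (X : 'M[V]_n) :
  r <= s -> pos (mxscale r (mxunit opunit n) + X) ->
  pos (mxscale s (mxunit opunit n) + X).
Proof.
move=> rs p.
have -> : mxscale s (mxunit opunit n) + X =
  mxscale (s - r) (mxunit opunit n) + (mxscale r (mxunit opunit n) + X).
  by apply/matrixP=> i j; rewrite !mxE addrA -scalerDl subrK.
by apply: posD => //; apply: posZ; [rewrite subr_ge0 | exact: pos_mxunit].
Qed.

End OperatorSystemTheory.

Section DirectSum.
Variables (R : realType) (S T : operatorSystemType R).
Local Notation ST := (S * T)%type.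

Let fst_mx n (X : 'M[ST]_n) : 'M[S]_n := map_mx fst X.
Let snd_mx n (X : 'M[ST]_n) : 'M[T]_n := map_mx snd X.

Definition dsum_star (u : ST) : ST := (star u.1, star u.2).
Definition dsum_pos n : set 'M[ST]_n :=
  [set X | pos (map_mx fst X) /\ pos (map_mx snd X)].
Definition dsum_unit : ST := (opunit, opunit).

Fact dsum_starK : involutive dsum_star.
Proof. by move=> [s t]; rewrite /dsum_star /= !starK. Qed.

Fact dsum_star_semilinear (c : R[i]) (x y : ST) :
  dsum_star (c *: x + y) = c^* *: dsum_star x + dsum_star y.
Proof.
by case: x y => [s t] [s' t']; rewrite /dsum_star /= !star_semilinear.
Qed.

Fact dsum_mx_eq n (X Y : 'M[ST]_n) :
  fst_mx X = fst_mx Y -> snd_mx X = snd_mx Y -> X = Y.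
Proof.
move=> /matrixP e1 /matrixP e2; apply/matrixP=> i j.
move: (e1 i j) (e2 i j); rewrite !mxE.
by case: (X i j) (Y i j) => [? ?] [? ?] /= -> ->.
Qed.

Fact dsum_sum1 I (r : seq I) (F : I -> ST) :
  (\sum_(i <- r) F i).1 = \sum_(i <- r) (F i).1.
Proof. exact: (big_morph fst). Qed.

Fact dsum_sum2 I (r : seq I) (F : I -> ST) :
  (\sum_(i <- r) F i).2 = \sum_(i <- r) (F i).2.
Proof. exact: (big_morph snd). Qed.

Fact dsum_unit1 n : fst_mx (mxunit dsum_unit n) = mxunit opunit n.
Proof. by apply/matrixP=> i j; rewrite !mxE; case: (i == j). Qed.

Fact dsum_unit2 n : snd_mx (mxunit dsum_unit n) = mxunit opunit n.
Proof. by apply/matrixP=> i j; rewrite !mxE; case: (i == j). Qed.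

Fact dsum_D1 n (X Y : 'M[ST]_n) : fst_mx (X + Y) = fst_mx X + fst_mx Y.
Proof. by apply/matrixP=> i j; rewrite !mxE. Qed.

Fact dsum_D2 n (X Y : 'M[ST]_n) : snd_mx (X + Y) = snd_mx X + snd_mx Y.
Proof. by apply/matrixP=> i j; rewrite !mxE. Qed.

Fact dsum_N1 n (X : 'M[ST]_n) : fst_mx (- X) = - fst_mx X.
Proof. by apply/matrixP=> i j; rewrite !mxE. Qed.

Fact dsum_N2 n (X : 'M[ST]_n) : snd_mx (- X) = - snd_mx X.
Proof. by apply/matrixP=> i j; rewrite !mxE. Qed.

Fact dsum_Z1 n c (X : 'M[ST]_n) : fst_mx (mxscale c X) = mxscale c (fst_mx X).
Proof. by apply/matrixP=> i j; rewrite !mxE. Qed.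

Fact dsum_Z2 n c (X : 'M[ST]_n) : snd_mx (mxscale c X) = mxscale c (snd_mx X).
Proof. by apply/matrixP=> i j; rewrite !mxE. Qed.

Fact dsum_star1 n (X : 'M[ST]_n) :
  fst_mx (mxstar dsum_star X) = mxstar star (fst_mx X).
Proof. by apply/matrixP=> i j; rewrite !mxE. Qed.

Fact dsum_star2 n (X : 'M[ST]_n) :
  snd_mx (mxstar dsum_star X) = mxstar star (snd_mx X).
Proof. by apply/matrixP=> i j; rewrite !mxE. Qed.

Fact dsum_compress1 n m (al : 'M[R[i]]_(n, m)) (X : 'M[ST]_n) :
  fst_mx (mxcompress al X) = mxcompress al (fst_mx X).
Proof.
apply/matrixP=> i j; rewrite !mxE dsum_sum1; apply: eq_bigr => k _.
by rewrite dsum_sum1; apply: eq_bigr => l _; rewrite mxE.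
Qed.

Fact dsum_compress2 n m (al : 'M[R[i]]_(n, m)) (X : 'M[ST]_n) :
  snd_mx (mxcompress al X) = mxcompress al (snd_mx X).
Proof.
apply/matrixP=> i j; rewrite !mxE dsum_sum2; apply: eq_bigr => k _.
by rewrite dsum_sum2; apply: eq_bigr => l _; rewrite mxE.
Qed.

Fact dsum_pos_herm n (X : 'M[ST]_n) : dsum_pos X -> mxstar dsum_star X = X.
Proof.
case=> p1 p2; apply: dsum_mx_eq.
  by rewrite dsum_star1; exact: pos_herm.
by rewrite dsum_star2; exact: pos_herm.
Qed.

Fact dsum_pos0 n : @dsum_pos n 0.
Proof.
have e1 : fst_mx (0 : 'M_n) = 0 by apply/matrixP=> i j; rewrite !mxE.
have e2 : snd_mx (0 : 'M_n) = 0 by apply/matrixP=> i j; rewrite !mxE.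
by split; [rewrite -/(fst_mx _) e1 | rewrite -/(snd_mx _) e2]; apply: pos0.
Qed.

Fact dsum_posD n (X Y : 'M[ST]_n) :
  dsum_pos X -> dsum_pos Y -> dsum_pos (X + Y).
Proof.
move=> [x1 x2] [y1 y2]; split.
  by rewrite -/(fst_mx _) dsum_D1; exact: posD.
by rewrite -/(snd_mx _) dsum_D2; exact: posD.
Qed.

Fact dsum_posZ n (t : R[i]) (X : 'M[ST]_n) :
  0 <= t -> dsum_pos X -> dsum_pos (mxscale t X).
Proof.
move=> t0 [x1 x2]; split.
  by rewrite -/(fst_mx _) dsum_Z1; exact: posZ.
by rewrite -/(snd_mx _) dsum_Z2; exact: posZ.
Qed.

Fact dsum_pos_proper n (X : 'M[ST]_n) :
  dsum_pos X -> dsum_pos (- X) -> X = 0.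
Proof.
move=> [x1 x2] [].
rewrite -/(fst_mx _) -/(snd_mx _) dsum_N1 dsum_N2 => y1 y2.
apply: dsum_mx_eq.
  by rewrite [LHS](pos_proper x1 y1); apply/matrixP=> i j; rewrite !mxE.
by rewrite [LHS](pos_proper x2 y2); apply/matrixP=> i j; rewrite !mxE.
Qed.

Fact dsum_pos_compress n m (al : 'M[R[i]]_(n, m)) (X : 'M[ST]_n) :
  dsum_pos X -> dsum_pos (mxcompress al X).
Proof.
move=> [x1 x2]; split.
  by rewrite -/(fst_mx _) dsum_compress1; exact: pos_compress.
by rewrite -/(snd_mx _) dsum_compress2; exact: pos_compress.
Qed.

Fact dsum_star_unit : dsum_star dsum_unit = dsum_unit.
Proof. by rewrite /dsum_star /= !star_opunit. Qed.

Fact dsum_order_unit n (X : 'M[ST]_n) : mxstar dsum_star X = X ->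
  exists2 r : R[i], 0 < r & dsum_pos (mxscale r (mxunit dsum_unit n) + X).
Proof.
move=> hX.
have h1 : mxstar star (fst_mx X) = fst_mx X by rewrite -dsum_star1 hX.
have h2 : mxstar star (snd_mx X) = snd_mx X by rewrite -dsum_star2 hX.
have [r r0 p1] := order_unit h1.
have [s s0 p2] := order_unit h2.
exists (r + s); first exact: addr_gt0.
split.
  rewrite -/(fst_mx _) dsum_D1 dsum_Z1 dsum_unit1.
  by apply: pos_unit_ge p1; rewrite lerDl ltW.
rewrite -/(snd_mx _) dsum_D2 dsum_Z2 dsum_unit2.
by apply: pos_unit_ge p2; rewrite lerDr ltW.
Qed.

Fact dsum_archimedean n (X : 'M[ST]_n) :
  (forall r : R[i], 0 < r -> dsum_pos (mxscale r (mxunit dsum_unit n) + X)) ->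
  dsum_pos X.
Proof.
move=> h; split; apply: archimedean => r /h [].
  by rewrite -/(fst_mx _) dsum_D1 dsum_Z1 dsum_unit1.
by rewrite -/(snd_mx (_ + _)) dsum_D2 dsum_Z2 dsum_unit2.
Qed.

HB.instance Definition _ := isOperatorSystem.Build R ST
  dsum_starK dsum_star_semilinear dsum_pos_herm dsum_pos0 dsum_posD dsum_posZ
  dsum_pos_proper dsum_pos_compress dsum_star_unit dsum_order_unit
  dsum_archimedean.

End DirectSum.

Definition is_kernel (R : realType) (U : operatorSystemType R) (J : set U) :=
  exists (W : operatorSystemType R) (f : {linear U -> W}),
    ucp f /\ J = [set u | f u = 0].

Section Quotient.
Variables (R : realType) (U : operatorSystemType R) (J : set U).
Hypothesis kerJ : is_kernel J.

(* The unused proof argument makes kernel_pred a key for the zmodClosed instance,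
   and hence makes the quotient type carry its operator system structure. *)
Definition kernel_pred of is_kernel J : U -> bool := fun u => `[< J u >].
Local Notation K := (kernel_pred kerJ).

Fact kernelE : exists (W : operatorSystemType R) (f : {linear U -> W}),
  ucp f /\ forall u, u \in K <-> f u = 0.
Proof.
have [W [f [ucpf JE]]] := kerJ; exists W, f; split=> // u.
have -> : (u \in K) = `[< J u >] by [].
by rewrite JE; split=> [/asboolP|fu]; last exact/asboolP.
Qed.

Fact kernel_zmod_closed : zmod_closed K.
Proof.
have [W [f [_ fP]]] := kernelE; split=> [|u v /fP fu /fP fv]; apply/fP.
  exact: linear0.
by rewrite linearB /= fu fv subrr.
Qed.

HB.instance Definition _ := GRing.isZmodClosed.Build U K kernel_zmod_closed.

Definition quotient := Quotient.quot (GRing.ZmodClosed.clone U K _).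

HB.instance Definition _ := GRing.Zmodule.on quotient.
HB.instance Definition _ := @EqQuotient.on quotient.

Definition quotient_map (u : U) : quotient := \pi_quotient u.

Fact quotient_mapP u v : reflect (quotient_map u = quotient_map v) (u - v \in K).
Proof.
rewrite Quotient.idealrBE; exact: eqP.
Qed.

Fact quotient_map_repr (x : quotient) : quotient_map (repr x) = x.
Proof. exact: reprK. Qed.

Fact quotient_map0P u : reflect (quotient_map u = 0) (u \in K).
Proof.
have -> : (0 : quotient) = quotient_map 0 by rewrite /quotient_map raddf0.
by rewrite -[u in u \in _]subr0; exact: quotient_mapP.
Qed.

Definition quotient_scale (c : R[i]) (x : quotient) : quotient :=
  quotient_map (c *: repr x).

Fact quotient_map_scale c u :
  quotient_map (c *: u) = quotient_scale c (quotient_map u).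
Proof.
have [W [f [_ fP]]] := kernelE.
apply/quotient_mapP/fP; rewrite -scalerBr linearZ /=.
have /quotient_mapP/fP -> : quotient_map u = quotient_map (repr (quotient_map u)).
  by rewrite quotient_map_repr.
by rewrite scaler0.
Qed.

Fact quotient_mapD u v : quotient_map (u + v) = quotient_map u + quotient_map v.
Proof. exact: raddfD. Qed.

Fact quotient_scaleA (a b : R[i]) x :
  quotient_scale a (quotient_scale b x) = quotient_scale (a * b) x.
Proof.
by rewrite -[x]quotient_map_repr -!quotient_map_scale scalerA.
Qed.

Fact quotient_scale1 : left_id 1 quotient_scale.
Proof. by move=> x; rewrite /quotient_scale scale1r quotient_map_repr. Qed.

Fact quotient_scaleDr : right_distributive quotient_scale +%R.
Proof.
move=> c x y; rewrite -[x]quotient_map_repr -[y]quotient_map_repr.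
by rewrite -quotient_mapD -!quotient_map_scale -quotient_mapD scalerDr.
Qed.

Fact quotient_scaleDl x : {morph quotient_scale^~ x : a b / a + b}.
Proof.
move=> a b; rewrite -[x]quotient_map_repr.
by rewrite -!quotient_map_scale -quotient_mapD scalerDl.
Qed.

HB.instance Definition _ := GRing.Zmodule_isLmodule.Build R[i] quotient
  quotient_scaleA quotient_scale1 quotient_scaleDr quotient_scaleDl.

Fact quotient_map_linear : linear quotient_map.
Proof. by move=> c u v; rewrite quotient_mapD quotient_map_scale. Qed.

HB.instance Definition _ :=
  GRing.isLinear.Build R[i] U quotient _ quotient_map quotient_map_linear.

Definition quotient_star (x : quotient) : quotient :=
  quotient_map (star (repr x)).

Definition quotient_unit : quotient := quotient_map opunit.

(* The image cones quotient_prepos need not be Archimedean: the cones of the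
   quotient are their Archimedean closures quotient_pos. *)
Definition quotient_prepos n : set 'M[quotient]_n :=
  [set X | exists u k : 'M[U]_n,
     [/\ X = map_mx quotient_map u, forall i j, J (k i j) & pos (u + k)]].

Definition quotient_pos n : set 'M[quotient]_n :=
  [set X | forall r : R[i], 0 < r ->
     quotient_prepos (mxscale r (mxunit quotient_unit n) + X)].

Local Notation q := quotient_map.
Local Notation qpos := quotient_pos.

Fact map_quotient_surj m n (X : 'M[quotient]_(m, n)) :
  exists u : 'M[U]_(m, n), X = map_mx q u.
Proof.
exists (map_mx repr X); apply/matrixP=> i j.
by rewrite !mxE quotient_map_repr.
Qed.

Fact quotient_preposP n (X : 'M[quotient]_n) :
  quotient_prepos X <-> exists2 u : 'M[U]_n, X = map_mx q u & pos u.
Proof.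
split=> [[u [k [-> Jk puk]]]|[u -> pu]].
  exists (u + k) => //; apply/matrixP=> i j; rewrite !mxE quotient_mapD.
  suff -> : q (k i j) = 0 by rewrite addr0.
  by apply/quotient_map0P/asboolP/Jk.
exists u, 0; split=> // [i j|]; last by rewrite addr0.
rewrite mxE; have /asboolP // : 0 \in K by exact: rpred0.
Qed.

Fact quotient_posP n (X : 'M[quotient]_n) :
  qpos X <-> forall r : R[i], 0 < r -> exists2 u : 'M[U]_n,
    mxscale r (mxunit quotient_unit n) + X = map_mx q u & pos u.
Proof. by split=> h r /h /quotient_preposP. Qed.

Fact quotient_posW n (u : 'M[U]_n) : pos u -> qpos (map_mx q u).
Proof.
move=> pu; apply/quotient_posP => r r0.
exists (mxscale r (mxunit opunit n) + u).
  apply/matrixP=> i j; rewrite !mxE linearD linearZ /=.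
  by rewrite (raddfMn quotient_map).
by apply: posD => //; apply: posZ (pos_mxunit _ _); exact: ltW.
Qed.

Fact kernel_star u : u \in K -> star u \in K.
Proof.
have [W [f [[f1 fcp] fP]]] := kernelE.
have herm x : star x = x -> star (f x) = f x.
  move=> sx; have hx : mxstar star (const_mx x : 'M_1) = const_mx x.
    by apply/matrixP=> i j; rewrite !mxE.
  have [r r0 /fcp/pos_herm/matrixP/(_ 0 0)] := order_unit hx.
  rewrite !mxE eqxx mulr1n linearD linearZ /= f1 starD starZ star_opunit.
  by rewrite (CrealP (gtr0_real r0)) => /addrI.
pose h := u + star u; pose k := 'i *: (u - star u).
have sh : star h = h by rewrite /h starD starK addrC.
have sk : star k = k.
  by rewrite /k starZ starD starN starK conjCi scaleNr -scalerN opprB.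
move=> /fP fu; apply/fP.
have := herm _ sh; rewrite /h linearD /= fu add0r => e1.
have := herm _ sk; rewrite /k linearZ linearB /= fu sub0r.
rewrite starZ starN e1 conjCi scaleNr scalerN opprK.
move=> /eqP; rewrite -subr_eq0 opprK -scalerDr scaler_eq0 (negPf (neq0Ci _)) /=.
by rewrite -mulr2n -scaler_nat scaler_eq0 pnatr_eq0 => /eqP.
Qed.

Fact quotient_map_star u : q (star u) = quotient_star (q u).
Proof.
apply/quotient_mapP; rewrite -starN -starD; apply: kernel_star.
by apply/quotient_mapP; rewrite quotient_map_repr.
Qed.

Fact quotient_starK : involutive quotient_star.
Proof.
by move=> x; rewrite -[x]quotient_map_repr -!quotient_map_star starK.
Qed.

Fact quotient_star_semilinear (c : R[i]) (x y : quotient) :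
  quotient_star (c *: x + y) = c^* *: quotient_star x + quotient_star y.
Proof.
rewrite -[x]quotient_map_repr -[y]quotient_map_repr -linearP.
by rewrite -!quotient_map_star star_semilinear linearP.
Qed.

Fact quotient_star_unit : quotient_star quotient_unit = quotient_unit.
Proof. by rewrite -quotient_map_star star_opunit. Qed.

Fact mxstar_quotient_map m n (u : 'M[U]_(m, n)) :
  mxstar quotient_star (map_mx q u) = map_mx q (mxstar star u).
Proof. by apply/matrixP=> i j; rewrite !mxE quotient_map_star. Qed.

Fact mxunit_quotient n : mxunit quotient_unit n = map_mx q (mxunit opunit n).
Proof. by apply/matrixP=> i j; rewrite !mxE raddfMn. Qed.

Fact mxscale_quotient c m n (u : 'M[U]_(m, n)) :
  mxscale c (map_mx q u) = map_mx q (mxscale c u).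
Proof. by apply/matrixP=> i j; rewrite !mxE linearZ. Qed.

Fact mxadd_quotient m n (u v : 'M[U]_(m, n)) :
  map_mx q u + map_mx q v = map_mx q (u + v).
Proof. by apply/matrixP=> i j; rewrite !mxE linearD. Qed.

Fact mxcompress_quotient n m (al : 'M[R[i]]_(n, m)) (u : 'M[U]_n) :
  mxcompress al (map_mx q u) = map_mx q (mxcompress al u).
Proof.
apply/matrixP=> i j; rewrite !mxE linear_sum; apply: eq_bigr => k _.
by rewrite linear_sum; apply: eq_bigr => l _; rewrite linearZ mxE.
Qed.

Fact quotient_pos_herm n (X : 'M[quotient]_n) :
  qpos X -> mxstar quotient_star X = X.
Proof.
move=> /quotient_posP/(_ 1 ltr01)[u e /pos_herm hu].
have /matrixP eX : X = map_mx q (u - mxunit opunit n).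
  apply/matrixP=> i j; move/matrixP: e => /(_ i j).
  rewrite !mxE linearB /= (raddfMn quotient_map) => <-.
  by rewrite scale1r addrAC subrr add0r.
apply/matrixP=> i j; rewrite mxE !eX !mxE -quotient_map_star starD starN.
move/matrixP: hu => /(_ i j); rewrite mxE => ->.
by rewrite eq_sym; case: (i == j); rewrite ?mulr1n ?star_opunit ?star0.
Qed.

Fact quotient_pos0 n : qpos (0 : 'M[quotient]_n).
Proof.
have -> : 0 = map_mx q (0 : 'M_n) by apply/matrixP=> i j; rewrite !mxE linear0.
exact/quotient_posW/pos0.
Qed.

Fact quotient_posD n (X Y : 'M[quotient]_n) :
  qpos X -> qpos Y -> qpos (X + Y).
Proof.
move=> /quotient_posP hX /quotient_posP hY; apply/quotient_posP => r r0.
have r20 : 0 < r / 2 by rewrite divr_gt0.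
have [u eu pu] := hX _ r20; have [v ev pv] := hY _ r20.
exists (u + v); last exact: posD.
rewrite -mxadd_quotient -eu -ev; apply/matrixP=> i j; rewrite !mxE.
by rewrite addrACA -scalerDl -splitr.
Qed.

Fact quotient_posZ n (t : R[i]) (X : 'M[quotient]_n) :
  0 <= t -> qpos X -> qpos (mxscale t X).
Proof.
rewrite le_eqVlt => /predU1P[<- _|t0 /quotient_posP hX].
  have -> : mxscale 0 X = 0 by apply/matrixP=> i j; rewrite !mxE scale0r.
  exact: quotient_pos0.
apply/quotient_posP => r r0.
have [u eu pu] := hX (r / t) (divr_gt0 r0 t0).
exists (mxscale t u); last by apply: posZ => //; exact: ltW.
rewrite -mxscale_quotient -eu; apply/matrixP=> i j; rewrite !mxE.
by rewrite scalerDr scalerA mulrCA divff ?mulr1 // gt_eqF.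
Qed.

Fact quotient_pos_proper n (X : 'M[quotient]_n) :
  qpos X -> qpos (- X) -> X = 0.
Proof.
have [W [f [[f1 fcp] fP]]] := kernelE.
have [u ->] := map_quotient_surj X.
have fpos (v : 'M[U]_n) : qpos (map_mx q v) -> pos (map_mx f v).
  move=> /quotient_posP h; apply: archimedean => r r0.
  have [w ew /fcp pw] := h r r0.
  rewrite (_ : _ + _ = map_mx f w) //; apply/matrixP=> i j.
  move/matrixP: ew => /(_ i j); rewrite mxunit_quotient mxscale_quotient.
  rewrite mxadd_quotient mxE [in RHS]mxE => /quotient_mapP/fP.
  rewrite linearB /= => /eqP; rewrite subr_eq0 => /eqP.
  by rewrite !mxE linearD linearZ /= (raddfMn f) /= f1.
have -> : - map_mx q u = map_mx q (- u).
  by apply/matrixP=> i j; rewrite !mxE linearN.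
move=> /fpos p1 /fpos; have -> : map_mx f (- u) = - map_mx f u.
  by apply/matrixP=> i j; rewrite !mxE linearN.
move=> /(pos_proper p1)/matrixP e0; apply/matrixP=> i j.
by rewrite !mxE; apply/quotient_map0P/fP; move: (e0 i j); rewrite !mxE.
Qed.

Fact mxcompressD n m (al : 'M[R[i]]_(n, m)) (u v : 'M[U]_n) :
  mxcompress al (u + v) = mxcompress al u + mxcompress al v.
Proof.
apply/matrixP=> i j; rewrite !mxE -big_split; apply: eq_bigr => k _.
by rewrite -big_split; apply: eq_bigr => l _; rewrite mxE scalerDr.
Qed.

Fact mxcompressZ n m (al : 'M[R[i]]_(n, m)) c (u : 'M[U]_n) :
  mxcompress al (mxscale c u) = mxscale c (mxcompress al u).
Proof.
apply/matrixP=> i j; rewrite !mxE scaler_sumr; apply: eq_bigr => k _.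
rewrite scaler_sumr; apply: eq_bigr => l _.
by rewrite mxE !scalerA mulrC.
Qed.

Fact quotient_pos_compress n m (al : 'M[R[i]]_(n, m)) (X : 'M[quotient]_n) :
  qpos X -> qpos (mxcompress al X).
Proof.
move=> /quotient_posP hX; apply/quotient_posP => r r0.
pose E := mxcompress al (mxunit (opunit : U) n).
have hE : mxstar star (- E) = - E.
  have /pos_herm/matrixP hE : pos E by exact/pos_compress/pos_mxunit.
  apply/matrixP=> i j; move: (hE i j); rewrite mxE => hij.
  by rewrite mxE [(- E) j i]mxE starN hij [RHS]mxE.
have [s s0 ps] := order_unit hE.
have d0 : 0 < r / s by exact: divr_gt0.
have [u eu pu] := hX _ d0.
have [v eX] := map_quotient_surj X; move: eu; rewrite {}eX => eu.
exists (mxscale (r / s) (mxscale s (mxunit opunit m) - E) + mxcompress al u).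
  have : mxcompress al (map_mx q u) =
         mxcompress al (map_mx q (mxscale (r / s) (mxunit opunit n) + v)).
    by rewrite -eu mxunit_quotient mxscale_quotient mxadd_quotient.
  rewrite mxcompress_quotient mxcompress_quotient mxcompressD mxcompressZ => e.
  rewrite -mxadd_quotient e mxunit_quotient mxscale_quotient.
  rewrite mxcompress_quotient !mxadd_quotient; congr map_mx.
  rewrite addrA -/E; congr (_ + _); apply/matrixP=> i j.
  rewrite [RHS]mxE [mxscale (r / s) E i j]mxE [LHS]mxE [X in X + _]mxE.
  rewrite [(_ - E) i j]mxE [(- E) i j]mxE [mxscale s _ i j]mxE.
  by rewrite scalerDr scalerA divfK ?gt_eqF // scalerN subrK.
by apply: posD; [apply: posZ => //; exact: ltW | exact: pos_compress].
Qed.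

Fact quotient_order_unit n (X : 'M[quotient]_n) :
  mxstar quotient_star X = X ->
  exists2 r : R[i], 0 < r & qpos (mxscale r (mxunit quotient_unit n) + X).
Proof.
have [u ->] := map_quotient_surj X; rewrite mxstar_quotient_map => e.
pose v := mxscale 2^-1 (u + mxstar star u).
have hv : mxstar star v = v.
  apply/matrixP=> i j; rewrite !mxE starZ starD starK addrC.
  by rewrite fmorphV rmorph_nat.
have ev : map_mx q u = map_mx q v.
  rewrite -mxscale_quotient -mxadd_quotient e; apply/matrixP=> i j.
  rewrite !mxE scalerDr -scalerDl (_ : 2^-1 + 2^-1 = 1) ?scale1r //.
  by rewrite -[2^-1]mul1r -splitr.
have [r r0 pr] := order_unit hv; exists r => //.
rewrite ev mxunit_quotient mxscale_quotient mxadd_quotient.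
exact: quotient_posW.
Qed.

Fact quotient_archimedean n (X : 'M[quotient]_n) :
  (forall r : R[i], 0 < r -> qpos (mxscale r (mxunit quotient_unit n) + X)) ->
  qpos X.
Proof.
move=> h; apply/quotient_posP => r r0.
have r20 : 0 < r / 2 by rewrite divr_gt0.
have /quotient_posP/(_ _ r20)[u eu pu] := h _ r20.
exists u => //; rewrite -eu; apply/matrixP=> i j; rewrite !mxE.
by rewrite addrA -scalerDl -splitr.
Qed.

HB.instance Definition _ := isOperatorSystem.Build R quotient
  quotient_starK quotient_star_semilinear quotient_pos_herm quotient_pos0
  quotient_posD quotient_posZ quotient_pos_proper quotient_pos_compress
  quotient_star_unit quotient_order_unit quotient_archimedean.

End Quotient.

(* a . X . a^* *)
Definition mxact (R : realType) (A : cstarAlgType R) (V : lmodType R[i])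
    (l : A -> V -> V) (r : V -> A -> V) n m
    (a : 'M[A]_(n, m)) (X : 'M[V]_m) : 'M[V]_n :=
  \matrix_(i, j) \sum_k \sum_h r (l (a i k) (X k h)) (cstar (a j h)).

Record opActionOn (R : realType) (A : cstarAlgType R)
    (S : operatorSystemType R) := OpActionOn {
  left_act : A -> S -> S;
  right_act : S -> A -> S;
  left_act_linearl : forall s, linear (left_act^~ s);
  left_act_linearr : forall a, linear (left_act a);
  right_act_linearl : forall a, linear (right_act^~ a);
  right_act_linearr : forall s, linear (right_act s);
  left_act1 : forall s, left_act 1 s = s;
  right_act1 : forall s, right_act s 1 = s;
  left_actM : forall a b s, left_act (a * b) s = left_act a (left_act b s);
  right_actM : forall s a b, right_act s (a * b) = right_act (right_act s a) b;
  left_right_act : forall a s b,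
    right_act (left_act a s) b = left_act a (right_act s b);
  left_act_star : forall a s, star (left_act a s) = right_act (star s) (cstar a);
  left_right_unit : forall a, left_act a opunit = right_act opunit a;
  pos_mxact : forall n m (a : 'M[A]_(n, m)) (X : 'M[S]_m),
    pos X -> pos (mxact left_act right_act a X)
}.

Record opASystem (R : realType) (A : cstarAlgType R) := OpASystem {
  opA_sort :> operatorSystemType R;
  opA_action : opActionOn A opA_sort
}.

Section OperatorASystems.
Variables (R : realType) (A : cstarAlgType R).

Definition lact (S : opASystem A) : A -> S -> S := left_act (opA_action S).
Definition ract (S : opASystem A) : S -> A -> S := right_act (opA_action S).

Definition faithful (S : opASystem A) :=
  forall a : A, a <> 0 -> lact a (opunit : S) <> 0.

Definition bimodule_map (S T : opASystem A) (f : {linear S -> T}) :=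
  forall (a b : A) (s : S), f (ract (lact a s) b) = ract (lact a (f s)) b.

Definition is_coproduct (S T P : opASystem A)
    (iS : {linear S -> P}) (iT : {linear T -> P}) :=
  [/\ faithful P,
      [/\ unital iS, complete_order_embedding iS & bimodule_map iS],
      [/\ unital iT, complete_order_embedding iT & bimodule_map iT]
    & forall (Q : opASystem A) (psi1 : {linear S -> Q}) (psi2 : {linear T -> Q}),
        ucp psi1 -> bimodule_map psi1 -> ucp psi2 -> bimodule_map psi2 ->
      let extends (Psi : {linear P -> Q}) :=
        [/\ ucp Psi, bimodule_map Psi,
            forall s, Psi (iS s) = psi1 s & forall t, Psi (iT t) = psi2 t] in
      exists Psi : {linear P -> Q},
        extends Psi /\ forall Psi' : {linear P -> Q}, extends Psi' -> Psi' =1 Psi].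

End OperatorASystems.

Section DirectSumAction.
Variables (R : realType) (A : cstarAlgType R) (S T : opASystem A).
Local Notation ST := (S * T)%type.

Definition dsum_lact (a : A) (u : ST) : ST := (lact a u.1, lact a u.2).
Definition dsum_ract (u : ST) (a : A) : ST := (ract u.1 a, ract u.2 a).

Fact dsum_mxact1 n m (a : 'M[A]_(n, m)) (X : 'M[ST]_m) :
  map_mx fst (mxact dsum_lact dsum_ract a X) =
  mxact (@lact _ _ S) (@ract _ _ S) a (map_mx fst X).
Proof.
apply/matrixP=> i j; rewrite !mxE dsum_sum1; apply: eq_bigr => k _.
by rewrite dsum_sum1; apply: eq_bigr => h _; rewrite mxE.
Qed.

Fact dsum_mxact2 n m (a : 'M[A]_(n, m)) (X : 'M[ST]_m) :
  map_mx snd (mxact dsum_lact dsum_ract a X) =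
  mxact (@lact _ _ T) (@ract _ _ T) a (map_mx snd X).
Proof.
apply/matrixP=> i j; rewrite !mxE dsum_sum2; apply: eq_bigr => k _.
by rewrite dsum_sum2; apply: eq_bigr => h _; rewrite mxE.
Qed.

Fact dsum_pos_mxact n m (a : 'M[A]_(n, m)) (X : 'M[ST]_m) :
  pos X -> pos (mxact dsum_lact dsum_ract a X).
Proof.
move=> [x1 x2]; split; first by rewrite dsum_mxact1; exact: pos_mxact.
by rewrite dsum_mxact2; exact: pos_mxact.
Qed.

Definition dsum_action : opActionOn A ST.
Proof.
apply: (@OpActionOn R A ST dsum_lact dsum_ract).
- move=> s c a b; congr pair; exact: left_act_linearl.
- move=> a c s t; congr pair; exact: left_act_linearr.
- move=> a c s t; congr pair; exact: right_act_linearl.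
- move=> s c a b; congr pair; exact: right_act_linearr.
- by move=> [s t]; congr pair; exact: left_act1.
- by move=> [s t]; congr pair; exact: right_act1.
- move=> a b s; congr pair; exact: left_actM.
- move=> s a b; congr pair; exact: right_actM.
- move=> a s b; congr pair; exact: left_right_act.
- move=> a s; congr pair; exact: left_act_star.
- move=> a; congr pair; exact: left_right_unit.
- exact: dsum_pos_mxact.
Defined.

Definition dsum : opASystem A := OpASystem dsum_action.

End DirectSumAction.

(* Main.v *)
From HB Require Import structures.
Require Import Defs.
From mathcomp Require Import all_boot all_order all_algebra complex.
From mathcomp Require Import generic_quotient ring_quotient.
From mathcomp Require Import boolp classical_sets reals.
From mathcomp Require Import ring lra.

(** Write A also for its copies a |-> a.e_S and a |-> a.e_T.  By the shape of
    J, a pair (s, t) of hermitian matrices is positive in the quotient when for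
    every r > 0 some matrix a over A has r + s + a >= 0 and r + t - a >= 0,
    that is, when an element of A nearly separates -s from t.  The theorem rests
    on two facts about the orders that S and T put on matrices over A.

    The two orders agree ([pos_amp_transfer]).  At level one, faithfulness
    forces every positive a.e to be the square of a selfadjoint element of A
    ([sq_pos_of_pos_amp]), and such squares are positive in every operator
    A-system.  Matrices over A reduce to level one by taking Schur complements.
    Consequently r - a >= 0 holds over S as soon as it holds over T, and
    r + X + a >= 0 then gives 2r + X >= 0: nothing new becomes positive, so S
    and T embed completely order isomorphically in the quotient.

    The order of A determines its norm ([cnorm_of_sq_pos]), for which A is
    complete.  If (s, t) and -(s, t) are both positive, elements of A nearly
    separating -s from t form a Cauchy sequence; its limit l satisfies s = -l
    and t = l ([antidiagonal_proper]).  So the Archimedean closures of the image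
    cones are proper, and J is the kernel of the quotient map onto the operator
    system they define ([archimedean_kernel_is_kernel]).

    The unit of the quotient is the class of (e_S, e_T), hence also of
    (2 e_S, 0); so S is embedded by s |-> (2s, 0) and T by t |-> (0, 2t).  Two
    ucp bimodule maps agree on A, so their half sum vanishes on J and descends
    to the quotient: this is the universal property.  The complete order
    isomorphism with any other coproduct follows from universality.

    The facts about C*-algebras are proved from the axioms without spectral
    theory.  Square roots come from the iteration y |-> (x + y^2) / 2, and norm
    bounds from the remark that c + iy is a multiple of a unitary when c and y
    are commuting selfadjoint elements with c^2 + y^2 scalar. *)

Set Implicit Arguments.
Unset Strict Implicit.
Unset Printing Implicit Defensive.

Import Order.TTheory GRing.Theory Num.Theory.

Local Open Scope classical_set_scope.
Local Open Scope ring_scope.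

(** * Norm, involution and limits in a C*-algebra *)
Section CStarBasics.
Variables (R : realType) (A : cstarAlgType R).
Implicit Types (x y z : A) (r : R).

Lemma cstar0 : cstar (0 : A) = 0.
Proof.
have := cstar_semilinear (-1 : R[i]) (0 : A) 0.
by rewrite scaler0 addr0 rmorphN1 scaleN1r addNr.
Qed.

Lemma cstarD x y : cstar (x + y) = cstar x + cstar y.
Proof. by have := cstar_semilinear 1 x y; rewrite rmorph1 !scale1r. Qed.

Lemma cstarZ (c : R[i]) x : cstar (c *: x) = c^* *: cstar x.
Proof. by have := cstar_semilinear c x 0; rewrite !addr0 cstar0 addr0. Qed.

Lemma cstarN x : cstar (- x) = - cstar x.
Proof. by rewrite -scaleN1r cstarZ rmorphN1 scaleN1r. Qed.

Lemma cstarB x y : cstar (x - y) = cstar x - cstar y.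
Proof. by rewrite cstarD cstarN. Qed.

Lemma cstar1 : cstar (1 : A) = 1.
Proof. by rewrite -[LHS]mul1r -[X in X * _]cstarK -cstarM mul1r cstarK. Qed.

Lemma conj_real r : (r%:C%C)^* = r%:C%C.
Proof. by apply/CrealP/complex_realP; exists r. Qed.

Lemma cstarZr r x : cstar (r%:C%C *: x) = r%:C%C *: cstar x.
Proof. by rewrite cstarZ conj_real. Qed.

Lemma cnormZr r x : 0 <= r -> cnorm (r%:C%C *: x) = r * cnorm x.
Proof.
move=> r0; apply: (@complexI R); rewrite cnormZ rmorphM /= ger0_norm //.
by rewrite lecR.
Qed.

Lemma cnorm0 : cnorm (0 : A) = 0.
Proof. by rewrite -(scale0r 0) (_ : 0 = 0%:C%C) // cnormZr // mul0r. Qed.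

Lemma cnormN x : cnorm (- x) = cnorm x.
Proof.
apply: (@complexI R); rewrite -scaleN1r cnormZ normrN1 mul1r //.
Qed.

Lemma cnorm_ge0 x : 0 <= cnorm x.
Proof. by have := cnormD x (- x); rewrite subrr cnorm0 cnormN; lra. Qed.

Lemma cnormB x y : cnorm (x - y) <= cnorm x + cnorm y.
Proof. by rewrite -(cnormN y) cnormD. Qed.

Lemma cnorm_star x : cnorm (cstar x) = cnorm x.
Proof.
have le z : cnorm z <= cnorm (cstar z).
  have := cnormM (cstar z) z; rewrite cstar_identity.
  by have := cnorm_ge0 z; have := cnorm_ge0 (cstar z); nra.
by apply/eqP; rewrite eq_le le -{2}(cstarK x) le.
Qed.

Lemma cnorm1 : cnorm (1 : A) = 1.
Proof.
have := cstar_identity (1 : A); rewrite cstar1 mulr1 => /eqP.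
rewrite -subr_eq0 expr2 -{1}[cnorm 1]mulr1 -mulrBr mulf_eq0 => /orP[/eqP /cnorm_eq0 /eqP|].
  by rewrite oner_eq0.
by rewrite subr_eq0 => /eqP <-.
Qed.

Lemma cstar_mul_eq0 x : cstar x * x = 0 -> x = 0.
Proof.
move=> e; apply: cnorm_eq0; apply/eqP; rewrite -sqrf_eq0.
by rewrite -cstar_identity e cnorm0.
Qed.

Definition ccvg (u : nat -> A) (l : A) := forall e : R, 0 < e ->
  exists N : nat, forall n : nat, (N <= n)%N -> cnorm (u n - l) < e.

Lemma ccvg_dominated (K : R) (u v : nat -> A) (l m : A) :
  (forall n, cnorm (v n - m) <= K * cnorm (u n - l)) -> ccvg u l -> ccvg v m.
Proof.
move=> dom cu e e0.
have K0 : 0 < `|K| + 1 by have := normr_ge0 K; lra.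
have [N hN] := cu (e / (`|K| + 1)) (divr_gt0 e0 K0).
exists N => n /hN; rewrite ltr_pdivlMr // => lt; apply: le_lt_trans (dom n) _.
by have := ler_norm K; have := cnorm_ge0 (u n - l); nra.
Qed.

Lemma ccvg_unique u l m : ccvg u l -> ccvg u m -> l = m.
Proof.
move=> cl cm; apply/eqP; rewrite -subr_eq0; apply/eqP/cnorm_eq0/eqP.
rewrite eq_le cnorm_ge0 andbT; apply/ler_addgt0Pl => e e0; rewrite addr0.
have e20 : 0 < e / 2 by lra.
have [N hN] := cl _ e20; have [M hM] := cm _ e20.
have := hN (maxn N M) (leq_maxl _ _); have := hM (maxn N M) (leq_maxr _ _).
have -> : l - m = (u (maxn N M) - m) - (u (maxn N M) - l).
  by rewrite opprB [RHS]addrC addrA subrK.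
by have := cnormB (u (maxn N M) - m) (u (maxn N M) - l); lra.
Qed.

Lemma ccvg_shift u l : ccvg u l -> ccvg (fun n => u n.+1) l.
Proof. by move=> cu e /cu[N hN]; exists N => n /leqW /hN. Qed.

Lemma ccvg_cnorm_le u l (B : R) :
  (forall n, cnorm (u n) <= B) -> ccvg u l -> cnorm l <= B.
Proof.
move=> uB cu; apply/ler_addgt0Pl => e /cu[N /(_ N (leqnn N)) lt].
have := cnormB (u N) (u N - l); rewrite opprB addrC subrK.
by have := uB N; lra.
Qed.

Lemma ccvgMl z u l : ccvg u l -> ccvg (fun n => z * u n) (z * l).
Proof.
by apply: (@ccvg_dominated (cnorm z)) => n; rewrite -mulrBr cnormM.
Qed.

Lemma ccvgMr z u l : ccvg u l -> ccvg (fun n => u n * z) (l * z).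
Proof.
by apply: (@ccvg_dominated (cnorm z)) => n; rewrite -mulrBl mulrC cnormM.
Qed.

Lemma ccvg_star u l : ccvg u l -> ccvg (fun n => cstar (u n)) (cstar l).
Proof.
by apply: (@ccvg_dominated 1) => n; rewrite -cstarB cnorm_star mul1r.
Qed.

Lemma ccvg_comm z u l : (forall n, z * u n = u n * z) -> ccvg u l -> z * l = l * z.
Proof.
move=> zu cu; apply: (ccvg_unique (ccvgMl z cu)).
by rewrite (_ : (fun n => _) = fun n => u n * z); [exact: ccvgMr | exact/funext].
Qed.

Lemma ccvg_sa u l : (forall n, cstar (u n) = u n) -> ccvg u l -> cstar l = l.
Proof.
move=> su cu; apply: (ccvg_unique (ccvg_star cu)).
by rewrite (_ : (fun n => _) = u) //; exact/funext.
Qed.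

(** The dominating real sequence is monotone and bounded, hence Cauchy, and its
    increments bound those of [u]: both iterations below converge this way,
    even when the first has no uniform contraction rate. *)
Lemma ccvg_majorant (u : nat -> A) (t : nat -> R) (B : R) :
  (forall n, t n <= B) -> (forall n, cnorm (u n.+1 - u n) <= t n.+1 - t n) ->
  exists l, ccvg u l.
Proof.
move=> tB ut; apply: cnorm_complete => e e0.
have dist m k : cnorm (u (m + k)%N - u m) <= t (m + k)%N - t m.
  elim: k => [|k IH]; first by rewrite addn0 !subrr cnorm0.
  have := cnormD (u (m + k).+1 - u (m + k)%N) (u (m + k)%N - u m).
  by rewrite addnS addrA subrK; have := ut (m + k)%N; lra.
have hs : has_sup (range t).
  by split; [exists (t 0%N), 0%N | exists B => _ [n _ <-]].
have [_ [N _ <-] hN] := @sup_adherent R (range t) (e / 2) ltac:(lra) hs.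
exists N => m n mN nN.
have tsup k : t k <= sup (range t) by apply: ub_le_sup; [exact: hs.2 | exists k].
have := dist N (m - N)%N; have := dist N (n - N)%N; rewrite !subnKC //.
have := cnormB (u m - u N) (u n - u N); rewrite opprB addrA subrK.
by have := tsup m; have := tsup n; lra.
Qed.

End CStarBasics.

(** * Square roots and the order of a C*-algebra *)
Section CStarOrder.
Variables (R : realType) (A : cstarAlgType R).
Implicit Types (x y z a : A) (r : R).

Let half_half x : (2^-1)%:C%C *: (x + x) = x.
Proof.
rewrite scalerDr -scalerDl -rmorphD /= (_ : 2^-1 + 2^-1 = 1 :> R) ?scale1r //.
by lra.
Qed.

(** The fixed points of y |-> (x + y^2) / 2 are the y with (1 - y)^2 = 1 - x.
    The same iteration on real numbers with x = 1, which increases and stays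
    below 1, dominates this one; that covers the case where [x] has norm 1. *)
Lemma sqrt_one_sub x : cstar x = x -> cnorm x <= 1 ->
  exists y, [/\ cstar y = y, cnorm y <= 1, (1 - y) * (1 - y) = 1 - x
    & forall z, z * x = x * z -> z * y = y * z].
Proof.
move=> sx x1.
pose y := fix y n := if n is n.+1 then (2^-1)%:C%C *: (x + y n * y n) else 0.
pose t := fix t n := if n is n.+1 then 2^-1 * (1 + t n * t n) else 0 : R.
have t01 n : 0 <= t n <= 1.
  by elim: n => [|n /andP[? ?]] /=; [rewrite lexx ler01 | apply/andP; split; nra].
have yt n : cnorm (y n) <= t n.
  elim: n => [|n IH] /=; first by rewrite cnorm0.
  rewrite cnormZr; last lra.
  have := cnormD x (y n * y n); have := cnormM (y n) (y n).
  by have := cnorm_ge0 (y n); nra.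
have ydt n : cnorm (y n.+1 - y n) <= t n.+1 - t n.
  elim: n => [|n IH].
    rewrite /= !subr0 mulr0 addr0 cnormZr; last lra.
    by rewrite mulr0 addr0 mulr1; lra.
  have -> : y n.+2 - y n.+1 = (2^-1)%:C%C *:
      (y n.+1 * (y n.+1 - y n) + (y n.+1 - y n) * y n).
    rewrite mulrBr mulrBl addrA subrK -[y n.+2]/(_ *: _) -[in LHS]/(y n.+1).
    by rewrite [X in _ - X = _]/= -scalerBr opprD addrACA subrr add0r.
  have -> : t n.+2 - t n.+1 =
      2^-1 * (t n.+1 * (t n.+1 - t n) + (t n.+1 - t n) * t n).
    by rewrite -[t n.+2]/(2^-1 * (1 + t n.+1 * t n.+1)) [X in _ - X = _]/=; ring.
  rewrite cnormZr ?ler_wpM2l//; try lra.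
  apply: le_trans (cnormD _ _) _; apply: lerD; apply: le_trans (cnormM _ _) _.
    by apply: ler_pM => //; exact: cnorm_ge0.
  by apply: ler_pM => //; exact: cnorm_ge0.
have [l yl] := ccvg_majorant (fun n => (andP (t01 n)).2) ydt.
have l1 : cnorm l <= 1.
  by apply: ccvg_cnorm_le yl => n; have := yt n; have := t01 n; lra.
have el : l + l = x + l * l.
  have yl' : ccvg (fun n => y n.+1) ((2^-1)%:C%C *: (x + l * l)).
    apply: (@ccvg_dominated _ _ 1 y _ l) yl => n.
    rewrite -[y n.+1]/((2^-1)%:C%C *: (x + y n * y n)) -scalerBr.
    have -> : x + y n * y n - (x + l * l) = y n * (y n - l) + (y n - l) * l.
      by rewrite mulrBr mulrBl addrA subrK opprD addrACA subrr add0r.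
    rewrite cnormZr; last lra.
    have := cnormD (y n * (y n - l)) ((y n - l) * l).
    have := cnormM (y n) (y n - l); have := cnormM (y n - l) l.
    have := cnorm_ge0 (y n - l); have := yt n; have := t01 n => /andP[_].
    by nra.
  have H := ccvg_unique (ccvg_shift yl) yl'.
  by rewrite -[RHS]half_half scalerDr -H.
have sy n : cstar (y n) = y n.
  by elim: n => [|n IH] /=; rewrite ?cstar0 // cstarZr cstarD cstarM sx IH.
exists l; split=> //; first exact: ccvg_sa yl.
  rewrite mulrBl mul1r mulrBr mulr1 opprB addrA addrAC -[1 - l - l]addrA.
  by rewrite -opprD el opprD addrA subrK.
move=> z zx; apply: ccvg_comm yl => n; elim: n => [|n IH] /=.
  by rewrite mul0r mulr0.
by rewrite -scalerAl -scalerAr mulrDr mulrDl zx mulrA IH -mulrA IH mulrA.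
Qed.

(** c + iy is r times a unitary, so its norm is at most r, and c is its real
    part. *)
Lemma cnorm_le_of_circle c y r : 0 <= r -> cstar c = c -> cstar y = y ->
  c * y = y * c -> c * c + y * y = (r ^+ 2)%:C%C%:A -> cnorm c <= r.
Proof.
move=> r0 sc sy cy e; pose u := c + 'i *: y.
have su : cstar u = c - 'i *: y by rewrite cstarD cstarZ sc sy conjCi scaleNr.
have nu : cnorm u <= r.
  have : cnorm u ^+ 2 = r ^+ 2.
    rewrite -cstar_identity su /u mulrBl !mulrDr.
    have -> : c * ('i *: y) = 'i *: y * c by rewrite -scalerAl -scalerAr cy.
    rewrite opprD addrA addrK -scalerAl -scalerAr scalerA.
    rewrite -['i * 'i]expr2 sqrCi scaleN1r.
    by rewrite opprK e cnormZr ?sqr_ge0 // cnorm1 mulr1.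
  by have := cnorm_ge0 u; nra.
have -> : c = (2^-1)%:C%C *: (u + cstar u).
  by rewrite su /u addrACA subrr addr0 half_half.
rewrite cnormZr; last lra.
by have := cnormD u (cstar u); rewrite cnorm_star; lra.
Qed.

(** Intrinsic positivity in A.  The commutation clause says that the root is a
    function of [a], so that roots of commuting elements commute. *)
Definition sq_pos a := exists d, [/\ cstar d = d, a = d * d
  & forall z, z * a = a * z -> z * d = d * z].

Lemma sq_pos_sa a : sq_pos a -> cstar a = a.
Proof. by move=> [d [sd -> _]]; rewrite cstarM sd. Qed.

Lemma sq_posZ r a : 0 < r -> sq_pos a -> sq_pos (r%:C%C *: a).
Proof.
move=> r0 [d [sd -> dz]]; exists ((Num.sqrt r)%:C%C *: d); split.
- by rewrite cstarZr sd.
- by rewrite -scalerAl -scalerAr scalerA -rmorphM /= -[Num.sqrt r * _]expr2 sqr_sqrtr // ltW.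
- move=> z; rewrite -scalerAl -scalerAr => /(congr1 ( *:%R (r^-1)%:C%C)).
  rewrite !scalerA -rmorphM /= mulVf ?gt_eqF // !scale1r => /dz e.
  by rewrite -scalerAl -scalerAr e.
Qed.

Lemma sq_pos_one_sub x : cstar x = x -> cnorm x <= 1 -> sq_pos (1 - x).
Proof.
move=> sx /(sqrt_one_sub sx)[y [sy _ e yz]]; exists (1 - y); split=> //.
  by rewrite cstarB cstar1 sy.
move=> z; rewrite mulrBr mulrBl mulr1 mul1r => /addrI /oppr_inj /yz zy.
by rewrite mulrBr mulrBl mulr1 mul1r zy.
Qed.

Lemma sq_pos_of_cnorm r x : 0 < r -> cstar x = x -> cnorm x <= r ->
  sq_pos (r%:C%C%:A - x).
Proof.
move=> r0 sx xr.
have -> : r%:C%C%:A - x = r%:C%C *: (1 - (r^-1)%:C%C *: x).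
  by rewrite scalerBr scalerA -rmorphM /= divff ?gt_eqF // scale1r.
apply/sq_posZ/sq_pos_one_sub => //; first by rewrite cstarZr sx.
rewrite cnormZr; last by rewrite invr_ge0 ltW.
by rewrite mulrC ler_pdivrMr // mul1r.
Qed.

(** An order interval is a norm ball: with d^2 = r - x and f^2 = r + x, the
    commuting elements x and df satisfy x^2 + (df)^2 = r^2. *)
Lemma cnorm_of_sq_pos r x : 0 <= r ->
  sq_pos (r%:C%C%:A - x) -> sq_pos (r%:C%C%:A + x) -> cnorm x <= r.
Proof.
move=> r0 [d [sd ed dz]] [f [sf ef fz]].
have comA z : z * r%:C%C%:A = r%:C%C%:A * z.
  by rewrite -scalerAl -scalerAr mul1r mulr1.
have dx : x * d = d * x by apply: dz; rewrite mulrBr mulrBl comA.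
have fx : x * f = f * x by apply: fz; rewrite mulrDr mulrDl comA.
have df : d * f = f * d by apply: fz; rewrite mulrDr mulrDl comA dx.
have sx : cstar x = x.
  have -> : x = f * f - r%:C%C%:A by rewrite -ef addrAC subrr add0r.
  by rewrite cstarB cstarM sf cstarZr cstar1.
apply: (@cnorm_le_of_circle x (d * f)) => //.
- by rewrite cstarM sd sf df.
- by rewrite mulrA dx -mulrA fx mulrA.
- have -> : d * f * (d * f) = (r%:C%C%:A - x) * (r%:C%C%:A + x).
    by rewrite ed ef {2}df mulrA -[d * f * f]mulrA -mulrA -[f * f * d]mulrA
      -df [f * (d * f)]mulrA -df !mulrA.
  rewrite mulrDr !mulrBl -(comA x) [X in _ + X = _]addrA subrK addrCA subrr addr0.
  by rewrite -scalerAl mul1r scalerA -rmorphM.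
Qed.

(** d^2 is the absolute value of y: the square root of y^2 is obtained as the
    square root of 1 - (1 - y^2), and 1 - y^2 has norm at most 1 because it is
    the square of an element completing y to a circle. *)
Lemma abs_exists y : cstar y = y -> cnorm y <= 1 ->
  exists d, [/\ cstar d = d, (d * d) * (d * d) = y * y
    & forall z, z * y = y * z -> z * d = d * z].
Proof.
move=> sy y1; have ny : cnorm (y * y) <= 1.
  by apply: le_trans (cnormM _ _) _; have := cnorm_ge0 y; nra.
have syy : cstar (y * y) = y * y by rewrite cstarM sy.
have [w [sw _ ew wz]] := sqrt_one_sub syy ny.
have sq_comm z : z * y = y * z -> z * (y * y) = y * y * z.
  by move=> zy; rewrite mulrA zy -mulrA zy mulrA.
have s1w : cstar (1 - w) = 1 - w by rewrite cstarB cstar1 sw.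
have n1w : cnorm (1 - w) <= 1.
  apply: (@cnorm_le_of_circle _ y) => //.
    by rewrite mulrBr mulrBl mulr1 mul1r wz // sq_comm.
  by rewrite ew subrK expr1n scale1r.
have syy1 : cstar (1 - y * y) = 1 - y * y by rewrite cstarB cstar1 syy.
have nyy1 : cnorm (1 - y * y) <= 1.
  rewrite -ew; apply: le_trans (cnormM _ _) _.
  by have := cnorm_ge0 (1 - w); nra.
have [v [sv nv ev vz]] := sqrt_one_sub syy1 nyy1.
have [d [sd ed dz]] := sq_pos_one_sub sv nv.
exists d; split=> //; first by rewrite -ed ev opprB addrC subrK.
move=> z zy; apply: dz; rewrite mulrBr mulrBl mulr1 mul1r vz //.
by rewrite mulrBr mulrBl mulr1 mul1r sq_comm.
Qed.

(** With h the absolute value of y and p = h - y, twice the negative part of y,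
    we have p h = - p y; compressing y by p thus gives a negative element,
    and it vanishes only if p does, in which case y = h is a square. *)
Lemma negative_part y : cstar y = y -> cnorm y <= 1 ->
  exists p g, [/\ cstar p = p, p * y * p = - (cstar g * g) & g = 0 -> sq_pos y].
Proof.
move=> sy /(abs_exists sy)[d [sd ed dz]].
have yd : y * d = d * y by exact: dz.
pose h := d * d; pose p := h - y; pose g := d * p.
have sp : cstar p = p by rewrite cstarB cstarM sd sy.
have hy : h * y = y * h by rewrite /h -mulrA -yd mulrA -yd mulrA.
have ph : p * h = - (p * y).
  by rewrite /p !mulrBl hy /h ed opprB.
have gg : cstar g * g = p * h * p by rewrite /g cstarM sp sd !mulrA.
exists p, g; split=> //; first by rewrite gg ph mulNr opprK.
move=> g0; have p0 : p = 0.
  have php : p * h * p = 0 by rewrite -gg g0 mulr0.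
  have pp : p * p = p * h + p * h by rewrite ph {2}/p mulrBr ph.
  have p3 : p * p * p = 0 by rewrite pp mulrDl php addr0.
  apply: cstar_mul_eq0; apply: cstar_mul_eq0.
  by rewrite sp cstarM sp mulrA p3 mul0r.
by exists d; split=> //; apply/eqP; rewrite eq_sym -subr_eq0 -[_ - _]/p p0.
Qed.

(** For M large, x = 1 - (a + r) / M has norm at most 1 - r / M < 1, and the
    Neumann series of x inverts 1 - x = (a + r) / M. *)
Lemma sq_pos_inv a r : 0 < r -> sq_pos a -> exists b,
  [/\ cstar b = b, (a + r%:C%C%:A) * b = 1 & b * (a + r%:C%C%:A) = 1].
Proof.
move=> r0 pa; have sa := sq_pos_sa pa.
pose M := cnorm a + r + r; pose y := a + r%:C%C%:A.
have M0 : 0 < M by rewrite /M; have := cnorm_ge0 a; lra.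
have M1 : M * M^-1 = 1 by rewrite divff // gt_eqF.
pose x := 1 - (M^-1)%:C%C *: y; pose rho := 1 - r * M^-1.
have sy : cstar y = y by rewrite cstarD cstarZr cstar1 sa.
have sx : cstar x = x by rewrite cstarB cstarZr cstar1 sy.
have iM0 : 0 < M^-1 by rewrite invr_gt0.
have rho0 : 0 <= rho by rewrite /rho -M1 /M; have := cnorm_ge0 a; nra.
have rho1 : rho < 1 by rewrite /rho; nra.
have xE : x = rho%:C%C%:A - (M^-1)%:C%C *: a.
  rewrite /x /y scalerDr scalerA -rmorphM /= mulrC opprD addrA addrAC.
  by rewrite /rho rmorphB /= scalerBl scale1r.
have nx : cnorm x <= rho.
  apply: cnorm_of_sq_pos => //.
    by rewrite xE opprB addrC subrK; exact: sq_posZ.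
  have -> : rho%:C%C%:A + x = (M^-1)%:C%C *: ((M * (rho + rho))%:C%C%:A - a).
    rewrite xE addrA -scalerDl -rmorphD scalerBr scalerA -rmorphM /=.
    by rewrite [M^-1 * _]mulrA [M^-1 * M]mulrC M1 mul1r.
  have MM : M * (rho + rho) = cnorm a + cnorm a + r + r.
    have Mr : M * rho = M - r by rewrite /rho mulrBr mulr1 mulrCA M1 mulr1.
    by rewrite mulrDr Mr /M addrK addrACA addrA.
  by apply/sq_posZ/sq_pos_of_cnorm => //; rewrite MM; have := cnorm_ge0 a; lra.
pose z := fix z n := if n is n.+1 then 1 + x * z n else 0.
pose t := fix t n := if n is n.+1 then 1 + rho * t n else 0 : R.
have tB n : t n <= (1 - rho)^-1.
  have e1 : (1 - rho) * (1 - rho)^-1 = 1 by rewrite divff // subr_eq0 gt_eqF.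
  have e2 : 0 < (1 - rho)^-1 by rewrite invr_gt0; lra.
  by elim: n => [|n IH] /=; [exact: ltW | nra].
have zdt n : cnorm (z n.+1 - z n) <= t n.+1 - t n.
  elim: n => [|n IH].
    by rewrite /= !subr0 !mulr0 !addr0 cnorm1.
  have -> : z n.+2 - z n.+1 = x * (z n.+1 - z n).
    by rewrite mulrBr [z n.+2]/= [X in _ - X = _]/= opprD addrACA subrr add0r.
  have -> : t n.+2 - t n.+1 = rho * (t n.+1 - t n).
    by rewrite mulrBr [t n.+2]/= [X in _ - X = _]/= opprD addrACA subrr add0r.
  by apply: le_trans (cnormM _ _) _; apply: ler_pM => //; exact: cnorm_ge0.
have [l zl] := ccvg_majorant tB zdt.
have el : (1 - x) * l = 1.
  have zl' : ccvg (fun n => z n.+1) (1 + x * l).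
    apply: (@ccvg_dominated _ _ (cnorm x) z _ l) zl => n.
    rewrite [z _]/= opprD addrACA subrr add0r -mulrBr; exact: cnormM.
  rewrite mulrBl mul1r {1}(ccvg_unique (ccvg_shift zl) zl') addrK //.
have sl : cstar l = l.
  have sel : cstar l * (1 - x) = 1.
    by have := congr1 cstar el; rewrite cstarM cstarB cstar1 sx.
  by rewrite -[LHS]mulr1 -el mulrA sel mul1r.
have ey : (1 - x) = (M^-1)%:C%C *: y by rewrite /x opprB addrC subrK.
exists ((M^-1)%:C%C *: l); split; first by rewrite cstarZr sl.
  by rewrite -scalerAr scalerAl -ey.
rewrite -scalerAl scalerAr -ey.
by have := congr1 cstar el; rewrite cstarM cstarB cstar1 sx sl.
Qed.

End CStarOrder.

(** * Matrices over A inside an operator A-system *)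
Section ModuleActions.
Variables (R : realType) (A : cstarAlgType R) (U : opASystem A).

Lemma lactP a (c : R[i]) (u v : U) : lact a (c *: u + v) = c *: lact a u + lact a v.
Proof. exact: left_act_linearr. Qed.

Lemma ractP a (c : R[i]) (u v : U) : ract (c *: u + v) a = c *: ract u a + ract v a.
Proof. exact: right_act_linearl. Qed.

Lemma lactD a (u v : U) : lact a (u + v) = lact a u + lact a v.
Proof. by rewrite -[u]scale1r lactP !scale1r. Qed.

Lemma ractD a (u v : U) : ract (u + v) a = ract u a + ract v a.
Proof. by rewrite -[u]scale1r ractP !scale1r. Qed.

Lemma lactB a (u v : U) : lact a (u - v) = lact a u - lact a v.
Proof. by rewrite addrC -scaleN1r lactP scaleN1r addrC. Qed.

Lemma ractB a (u v : U) : ract (u - v) a = ract u a - ract v a.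
Proof. by rewrite addrC -scaleN1r ractP scaleN1r addrC. Qed.

Lemma lact0 a : lact a (0 : U) = 0.
Proof. by rewrite -[X in lact _ X](subrr (0 : U)) lactB subrr. Qed.

Lemma ract0 a : ract (0 : U) a = 0.
Proof. by rewrite -[X in ract X _](subrr (0 : U)) ractB subrr. Qed.

Lemma lactZ a (c : R[i]) (u : U) : lact a (c *: u) = c *: lact a u.
Proof. by rewrite -[_ *: u]addr0 lactP lact0 addr0. Qed.

Lemma ractZ a (c : R[i]) (u : U) : ract (c *: u) a = c *: ract u a.
Proof. by rewrite -[_ *: u]addr0 ractP ract0 addr0. Qed.

Lemma mxactD m n (a : 'M[A]_(m, n)) (u v : 'M[U]_n) :
  mxact (@lact _ _ U) (@ract _ _ U) a (u + v) =
  mxact (@lact _ _ U) (@ract _ _ U) a u + mxact (@lact _ _ U) (@ract _ _ U) a v.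
Proof.
apply/matrixP=> i j; rewrite !mxE -big_split; apply: eq_bigr => k _.
rewrite -big_split; apply: eq_bigr => l _.
by rewrite mxE lactD ractD.
Qed.

Lemma mxactZ m n (a : 'M[A]_(m, n)) (c : R[i]) (u : 'M[U]_n) :
  mxact (@lact _ _ U) (@ract _ _ U) a (mxscale c u) =
  mxscale c (mxact (@lact _ _ U) (@ract _ _ U) a u).
Proof.
apply/matrixP=> i j; rewrite !mxE scaler_sumr; apply: eq_bigr => k _.
rewrite scaler_sumr; apply: eq_bigr => l _.
by rewrite mxE lactZ ractZ.
Qed.

End ModuleActions.

Section UnitOrbit.
Variables (R : realType) (A : cstarAlgType R).

Definition aunit (S : opASystem A) (a : A) : S := lact a opunit.

Fact aunit_linear (S : opASystem A) : linear (aunit S).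
Proof. exact: left_act_linearl. Qed.

HB.instance Definition _ (S : opASystem A) :=
  GRing.isLinear.Build R[i] A S _ (aunit S) (aunit_linear S).

Definition amp (S : opASystem A) m n (X : 'M[A]_(m, n)) : 'M[S]_(m, n) :=
  map_mx (aunit S) X.

Definition adjmx m n (X : 'M[A]_(m, n)) : 'M[A]_(n, m) := (map_mx cstar X)^T.

Lemma adjmxM m n p (X : 'M[A]_(m, n)) (Y : 'M[A]_(n, p)) :
  adjmx (X *m Y) = adjmx Y *m adjmx X.
Proof.
apply/matrixP=> i j; rewrite !mxE (big_morph _ (@cstarD _ _) (@cstar0 _ _)).
by apply: eq_bigr => k _; rewrite !mxE cstarM.
Qed.

Lemma adjmx_scalar n (a : A) : adjmx (a%:M : 'M_n) = (cstar a)%:M.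
Proof.
apply/matrixP=> i j; rewrite !mxE eq_sym.
by case: (i == j); rewrite ?mulr1n ?mulr0n ?cstar0.
Qed.

Lemma adjmx0 m n : adjmx (0 : 'M_(m, n)) = 0.
Proof. by apply/matrixP=> i j; rewrite !mxE cstar0. Qed.

Lemma adjmx_row m n1 n2 (X : 'M[A]_(m, n1)) (Y : 'M[A]_(m, n2)) :
  adjmx (row_mx X Y) = col_mx (adjmx X) (adjmx Y).
Proof. by rewrite /adjmx map_row_mx tr_row_mx. Qed.

Lemma adjmx_col m1 m2 n (X : 'M[A]_(m1, n)) (Y : 'M[A]_(m2, n)) :
  adjmx (col_mx X Y) = row_mx (adjmx X) (adjmx Y).
Proof. by rewrite /adjmx map_col_mx tr_col_mx. Qed.

Variable S : opASystem A.

Lemma lact_aunit a b : lact a (aunit S b) = aunit S (a * b).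
Proof. by rewrite /aunit /lact left_actM. Qed.

Lemma ract_aunit a b : ract (aunit S a) b = aunit S (a * b).
Proof.
by rewrite /ract /aunit /lact left_right_act -left_right_unit left_actM.
Qed.

Lemma aunit1 : aunit S 1 = opunit.
Proof. exact: left_act1. Qed.

Lemma star_aunit a : star (aunit S a) = aunit S (cstar a).
Proof.
by rewrite /aunit /lact left_act_star star_opunit left_right_unit.
Qed.

Lemma aunit_inj : faithful S -> injective (aunit S).
Proof.
move=> faith a b e; apply/eqP; rewrite -subr_eq0; apply/eqP.
apply: contrapT => /faith; apply.
by rewrite -/(aunit S (a - b)) linearB /= e subrr.
Qed.

Lemma ampD n (X Y : 'M[A]_n) : amp S (X + Y) = amp S X + amp S Y.
Proof. by apply/matrixP=> i j; rewrite !mxE linearD. Qed.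

Lemma ampN n (X : 'M[A]_n) : amp S (- X) = - amp S X.
Proof. by apply/matrixP=> i j; rewrite !mxE linearN. Qed.

Lemma amp_unit n (c : R[i]) :
  amp S (c%:A%:M : 'M_n) = mxscale c (mxunit opunit n).
Proof.
apply/matrixP=> i j; rewrite !mxE raddfMn /= linearZ /= aunit1.
by case: (i == j); rewrite ?mulr1n ?mulr0n ?scaler0.
Qed.

Lemma amp_adj n (X : 'M[A]_n) : mxstar star (amp S X) = amp S (adjmx X).
Proof. by apply/matrixP=> i j; rewrite !mxE star_aunit. Qed.

Lemma amp_inj m n : faithful S -> injective (@amp S m n).
Proof.
move=> faith X Y /matrixP e; apply/matrixP=> i j.
by apply: aunit_inj => //; have := e i j; rewrite !mxE.
Qed.

Lemma pos_amp_adj n (X : 'M[A]_n) :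
  faithful S -> pos (amp S X) -> adjmx X = X.
Proof.
by move=> faith /pos_herm; rewrite amp_adj => /amp_inj-/(_ faith).
Qed.

Lemma pos_amp_conj m n (b : 'M[A]_(m, n)) (X : 'M[A]_n) :
  pos (amp S X) -> pos (amp S (b *m X *m adjmx b)).
Proof.
move=> /(pos_mxact (opA_action S) b); congr pos.
apply/matrixP=> i j; rewrite !mxE linear_sum exchange_big /=.
apply: eq_bigr => h _; rewrite mxE mulr_suml linear_sum.
by apply: eq_bigr => k _; rewrite !mxE /= -ract_aunit -lact_aunit.
Qed.

Lemma pos_amp1 n : pos (amp S (1%:M : 'M_n)).
Proof.
rewrite (_ : 1%:M = (1%:A : A)%:M); last by rewrite scale1r.
by rewrite amp_unit; apply: posZ => //; exact: pos_mxunit.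
Qed.

Lemma pos_amp_cstar_mul (a : A) : pos (amp S ((cstar a * a)%:M : 'M_1)).
Proof.
have := pos_amp_conj (cstar a)%:M (pos_amp1 1).
by rewrite adjmx_scalar cstarK mulmx1 scalar_mxM.
Qed.

Lemma pos_amp_sq_pos (a : A) : sq_pos a -> pos (amp S (a%:M : 'M_1)).
Proof. by move=> [d [sd -> _]]; rewrite -{1}sd; exact: pos_amp_cstar_mul. Qed.

Lemma pos_ampZ n (r : R) (X : 'M[A]_n) :
  0 <= r -> pos (amp S X) -> pos (amp S (map_mx ( *:%R r%:C%C) X)).
Proof.
move=> r0 /(posZ (_ : 0 <= r%:C%C)); rewrite lecR => /(_ r0).
by congr pos; apply/matrixP=> i j; rewrite !mxE linearZ.
Qed.

(** Compressing a.e >= 0 by the negative part of [a] gives an element that is both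
    positive and negative, hence zero; by faithfulness it is already zero in A,
    so [a] has no negative part. *)
Lemma sq_pos_of_pos_amp (a : A) :
  faithful S -> pos (amp S (a%:M : 'M_1)) -> sq_pos a.
Proof.
move=> faith pa.
have sa : cstar a = a.
  have := pos_amp_adj faith pa; rewrite adjmx_scalar => /matrixP/(_ 0 0).
  by rewrite !mxE.
pose M := cnorm a + 1; have M0 : 0 < M by rewrite /M; have := cnorm_ge0 a; lra.
have iM0 : 0 < M^-1 by rewrite invr_gt0.
pose y := (M^-1)%:C%C *: a.
have ay : a = M%:C%C *: y.
  by rewrite scalerA -rmorphM /= divff ?gt_eqF // scale1r.
have sy : cstar y = y by rewrite cstarZr sa.
have ny : cnorm y <= 1.
  rewrite cnormZr; last exact: ltW.
  by rewrite mulrC ler_pdivrMr // mul1r /M; lra.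
have py : pos (amp S (y%:M : 'M_1)).
  have := pos_ampZ (ltW iM0) pa; congr (pos (amp S _)).
  by apply/matrixP=> i j; rewrite !mxE !ord1.
rewrite ay; apply: sq_posZ => //.
have [p [g [sp e]]] := negative_part sy ny; apply.
apply: cstar_mul_eq0.
have := pos_amp_conj p%:M py; rewrite adjmx_scalar sp -!scalar_mxM e.
rewrite (_ : (- _)%:M = - (cstar g * g)%:M); last first.
  by apply/matrixP=> i j; rewrite !mxE !ord1.
rewrite ampN => /(pos_proper (pos_amp_cstar_mul g)).
move=> /matrixP/(_ 0 0); rewrite !mxE /= => e0.
by apply: (aunit_inj faith); rewrite linear0.
Qed.

End UnitOrbit.

Section CompareMatrixOrders.
Variables (R : realType) (A : cstarAlgType R) (S T : opASystem A).
Hypothesis faithT : faithful T.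

(** The order that a faithful system induces on matrices over A is the smallest
    one.  After adding a small multiple r of the unit, the corner entry is
    a + r with [a] a square, hence invertible; the matrix is then congruent to
    the direct sum of its corner and the Schur complement.  The corner is
    positive in every system, and the Schur complement, a compression of the
    matrix, is positive by induction on the size. *)
Lemma pos_amp_transfer n (X : 'M[A]_n) : pos (amp T X) -> pos (amp S X).
Proof.
elim: n X => [|n IH] X pX.
  by rewrite (_ : amp S X = 0); [exact: pos0 | apply/matrixP=> -[]].
apply: archimedean => r r0.
have [e re] : exists e : R, r = e%:C%C.
  by apply/complex_realP/gtr0_real.
have e0 : 0 < e by rewrite -ltcR -re.
rewrite -amp_unit -ampD.
pose Y : 'M[A]_(1 + n) := r%:A%:M + X; rewrite -[r%:A%:M + X]/Y.
have pY : pos (amp T Y).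
  rewrite ampD amp_unit; apply: posD => //; apply: posZ; first exact: ltW.
  exact: pos_mxunit.
have aY := pos_amp_adj faithT pY.
pose a := X 0 0; have pa : sq_pos a.
  apply: (sq_pos_of_pos_amp faithT).
  have := pos_amp_conj (delta_mx 0 0 : 'M_(1, n.+1)) pX.
  congr (pos (amp T _)); apply/matrixP=> i j; rewrite !ord1.
  rewrite -rowE mxE (bigD1 0) //= big1 => [|k k0].
    by rewrite !mxE /= cstar1 mulr1 addr0.
  by rewrite !mxE (negPf k0) /= cstar0 mulr0.
have [b [sb ab ba]] := sq_pos_inv e0 pa.
pose al : 'M[A]_1 := ulsubmx Y; pose be : 'M[A]_1 := b%:M.
pose u := dlsubmx Y; pose D := drsubmx Y.
have alE : al = (a + e%:C%C%:A)%:M.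
  rewrite [al]mx11_scalar; congr (_%:M); rewrite !mxE addrC re.
  have -> : lshift n (0 : 'I_1) = 0 :> 'I_n.+1 by exact/val_inj.
  by rewrite eqxx mulr1n.
have alb : al *m be = 1%:M by rewrite alE -scalar_mxM ab.
have bal : be *m al = 1%:M by rewrite alE -scalar_mxM ba.
have sbe : adjmx be = be by rewrite adjmx_scalar sb.
have YE : Y = block_mx al (adjmx u) u D.
  rewrite -[LHS]submxK; congr block_mx.
  by rewrite -{1}aY /adjmx /u; apply/matrixP=> i j; rewrite !mxE.
(* [w] is the last block row of the inverse of the lower unitriangular factor of
   [Y]: the product of [w] and [Y] is [row_mx 0 D']. *)
pose D' := D - u *m be *m adjmx u.
pose w := row_mx (- (u *m be)) 1%:M.
have pD' : pos (amp S D').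
  apply: IH; have := pos_amp_conj w pY; congr (pos (amp T _)).
  rewrite YE mul_row_block adjmx_row mul_row_col !mul1mx adjmx_scalar cstar1.
  by rewrite mulNmx -mulmxA bal mulmx1 addNr mul0mx add0r mulmx1 mulNmx addrC.
(* The columns of that factor, which rebuild [Y] from [al] and [D']. *)
pose c1 := col_mx 1%:M (u *m be); pose c2 : 'M[A]_(1 + n, n) := col_mx 0 1%:M.
have -> : Y = c1 *m al *m adjmx c1 + c2 *m D' *m adjmx c2.
  rewrite /c1 /c2 !adjmx_col adjmxM sbe !adjmx_scalar adjmx0 cstar1.
  rewrite [_ *m al]mul_col_mx [_ *m D']mul_col_mx !mul_col_row !mul0mx !mul1mx -[u *m be *m al]mulmxA bal.
  rewrite !mulmx1 !mulmx0 mulmxA alb mul1mx add_block_mx !addr0.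
  by rewrite YE /D' mulmxA [_ + (D - _)]addrC subrK.
rewrite ampD; apply: posD; apply: pos_amp_conj => //.
rewrite alE raddfD ampD /=; apply: posD; first exact: pos_amp_sq_pos.
rewrite amp_unit -re; apply: posZ; first exact: ltW.
exact: pos_mxunit.
Qed.

End CompareMatrixOrders.

(** Compressions and the action of A do not preserve the unit, but turn it into
    a positive matrix [E]; this is how an error term d E is replaced by r times
    the unit in the Archimedean closure. *)
Lemma unit_absorbs_pos (R : realType) (V : operatorSystemType R) n
    (E : 'M[V]_n) (r : R[i]) : pos E -> 0 < r ->
  exists2 d : R[i], 0 < d & forall W : 'M[V]_n,
    pos (mxscale d E + W) -> pos (mxscale r (mxunit opunit n) + W).
Proof.
move=> pE r0.
have hE : mxstar star (- E) = - E.
  apply/matrixP=> i j; move/pos_herm/matrixP: pE => /(_ i j); rewrite mxE => Eij.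
  by rewrite mxE [(- E) j i]mxE starN Eij [RHS]mxE.
have [s s0 ps] := order_unit hE; have rs0 : 0 < r / s by exact: divr_gt0.
exists (r / s) => // W /(posD (posZ (ltW rs0) ps)); congr pos.
apply/matrixP=> i j; rewrite !mxE addrA -scalerDr subrK scalerA divfK //.
by rewrite gt_eqF.
Qed.

(** * Kernels from Archimedean cones *)
Section ArchimedeanQuotient.
Local Open Scope quotient_scope.
Variables (R : realType) (U : operatorSystemType R) (J : set U).

(** The preimage in U of the cone of the quotient by [J], written without
    mentioning the quotient: at this stage [J] is not yet known to be a kernel. *)
Definition precone n : set 'M[U]_n := [set u | forall r : R[i], 0 < r ->
  exists2 k : 'M[U]_n, (forall i j, J (k i j)) &
    pos (mxscale r (mxunit opunit n) + u + k)].

(** Properness is asked at level one only; [precone_proper] recovers the matrix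
    levels. *)
Record archimedean_kernel : Prop := ArchimedeanKernel {
  ak0 : J 0;
  ak_linear : forall (c : R[i]) u v, J u -> J v -> J (c *: u + v);
  ak_star : forall u, J u -> J (star u);
  ak_proper : forall u, @precone 1 (const_mx u) -> @precone 1 (const_mx (- u)) -> J u
}.

Hypothesis akJ : archimedean_kernel.

Lemma akD u v : J u -> J v -> J (u + v).
Proof. by move=> Ju; rewrite -[u]scale1r; exact: ak_linear. Qed.

Lemma akZ c u : J u -> J (c *: u).
Proof. by move=> Ju; rewrite -[_ *: _]addr0; apply: ak_linear => //; exact: ak0. Qed.

Lemma akN u : J u -> J (- u).
Proof. by move=> Ju; rewrite -scaleN1r; exact: akZ. Qed.

Lemma akB u v : J u -> J v -> J (u - v).
Proof. by move=> Ju /akN; exact: akD. Qed.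

Lemma ak_sum I (s : seq I) (F : I -> U) :
  (forall i, J (F i)) -> J (\sum_(i <- s) F i).
Proof. by move=> JF; apply: big_ind; [exact: ak0 | exact: akD |]. Qed.

Lemma precone_pos n (u : 'M[U]_n) : pos u -> precone u.
Proof.
move=> pu r r0; exists 0 => [i j|]; first by rewrite mxE; exact: ak0.
by rewrite addr0; apply: posD => //; apply: posZ (pos_mxunit _ _); exact: ltW.
Qed.

Lemma precone_eqmod n (u v : 'M[U]_n) :
  (forall i j, J (u i j - v i j)) -> precone u -> precone v.
Proof.
move=> uv pu r /pu[k Jk pk]; exists (k + (u - v)) => [i j|].
  by rewrite !mxE; exact: akD.
  by rewrite [k + _]addrC addrA -[_ + v + _]addrA [v + _]addrC subrK.
Qed.

Lemma precone_herm n (u : 'M[U]_n) i j :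
  precone u -> J (u i j - star (u j i)).
Proof.
move=> /(_ 1 ltr01)[k Jk /pos_herm/matrixP/(_ i j)].
rewrite !mxE !scale1r !starD [j == i]eq_sym.
have -> : star (opunit *+ (i == j)) = opunit *+ (i == j) :> U.
  by case: (i == j); rewrite ?mulr1n ?mulr0n ?star_opunit ?star0.
rewrite -!addrA => /addrI e.
have -> : u i j - star (u j i) = star (k j i) - k i j.
  by apply/eqP; rewrite subr_eq addrAC eq_sym subr_eq addrC e.
by apply: akB => //; exact: (ak_star akJ).
Qed.

Lemma preconeD n (u v : 'M[U]_n) : precone u -> precone v -> precone (u + v).
Proof.
move=> pu pv r r0; have r20 : 0 < r / 2 by rewrite divr_gt0.
have [k Jk pk] := pu _ r20; have [l Jl pl] := pv _ r20.
exists (k + l) => [i j|]; first by rewrite mxE; exact: akD.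
have := posD pk pl; congr pos; apply/matrixP=> i j; rewrite !mxE.
by rewrite addrACA; congr (_ + _); rewrite addrACA -scalerDl -splitr.
Qed.

Lemma preconeZ n (t : R[i]) (u : 'M[U]_n) :
  0 <= t -> precone u -> precone (mxscale t u).
Proof.
rewrite le_eqVlt => /predU1P[<- _|t0 pu r r0].
  rewrite (_ : mxscale 0 u = 0); first exact/precone_pos/pos0.
  by apply/matrixP=> i j; rewrite !mxE scale0r.
have [k Jk pk] := pu _ (divr_gt0 r0 t0).
exists (mxscale t k) => [i j|]; first by rewrite mxE; exact: akZ.
have := posZ (ltW t0) pk; congr pos; apply/matrixP=> i j; rewrite !mxE.
by rewrite !scalerDr scalerA mulrCA divff ?mulr1 // gt_eqF.
Qed.

Lemma precone_compress n m (al : 'M[R[i]]_(n, m)) (u : 'M[U]_n) :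
  precone u -> precone (mxcompress al u).
Proof.
move=> pu r r0.
have pE : pos (mxcompress al (mxunit (opunit : U) n)).
  exact/pos_compress/pos_mxunit.
have [d d0 absorb] := unit_absorbs_pos pE r0; have [k Jk pk] := pu _ d0.
exists (mxcompress al k) => [i j|].
  by rewrite mxE; apply: ak_sum => a; apply: ak_sum => b; exact: akZ.
rewrite -addrA; apply: absorb; rewrite addrA.
by have := pos_compress al pk; rewrite !mxcompressD mxcompressZ.
Qed.

Lemma precone_order_unit n (u : 'M[U]_n) : (forall i j, J (u i j - star (u j i))) ->
  exists2 r : R[i], 0 < r & precone (mxscale r (mxunit opunit n) + u).
Proof.
move=> hu; pose v := mxscale 2^-1 (u + mxstar star u).
have hv : mxstar star v = v.
  apply/matrixP=> i j; rewrite !mxE starZ starD starK addrC.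
  by rewrite fmorphV rmorph_nat.
have [r r0 /precone_pos pr] := order_unit hv; exists r => //.
apply: precone_eqmod pr => i j; rewrite !mxE opprD addrACA subrr add0r.
have -> : 2^-1 *: (u i j + star (u j i)) - u i j = - 2^-1 *: (u i j - star (u j i)).
  rewrite scaleNr -scalerN opprB scalerDr scalerBr addrAC addrC; congr (_ + _).
  have {2}-> : u i j = 2^-1 *: u i j + 2^-1 *: u i j.
    by rewrite -scalerDl -[2^-1]mul1r -splitr scale1r.
  by rewrite opprD addrA subrr add0r.
exact: akZ.
Qed.

Lemma precone_archimedean n (u : 'M[U]_n) :
  (forall r : R[i], 0 < r -> precone (mxscale r (mxunit opunit n) + u)) ->
  precone u.
Proof.
move=> h r r0; have r20 : 0 < r / 2 by rewrite divr_gt0.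
have [k Jk pk] := h _ r20 _ r20; exists k => //; move: pk; congr pos.
by apply/matrixP=> i j; rewrite !mxE addrA -scalerDl -splitr.
Qed.

Let pick n (c : R[i]) i j (v : 'I_n -> U) :
  \sum_l ((c *+ (l == i) + (l == j)%:R) *: v l) = c *: v i + v j.
Proof.
under eq_bigr => l _ do rewrite scalerDl.
rewrite big_split /=; congr (_ + _).
  rewrite (bigD1 i) //= eqxx big1 ?addr0 // => l /negPf ->.
  by rewrite mulr0n scale0r.
rewrite (bigD1 j) //= eqxx scale1r big1 ?addr0 // => l /negPf ->.
by rewrite scale0r.
Qed.

(** Polarization: compressing by the column c e_a + e_b produces
    |c|^2 u_aa + c^* u_ab + c u_ba + u_bb, and the values c = 0, 1, i isolate
    the entries modulo [J]. *)
Lemma precone_proper n (u : 'M[U]_n) i j :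
  precone u -> precone (- u) -> J (u i j).
Proof.
move=> pu pNu.
have polar (c : R[i]) a b :
    J (c^* *: (c *: u a a + u a b) + (c *: u b a + u b b)).
  pose al : 'M[R[i]]_(n, 1) := \col_l (c *+ (l == a) + (l == b)%:R).
  have compE : mxcompress al u =
      const_mx (c^* *: (c *: u a a + u a b) + (c *: u b a + u b b)).
    apply/matrixP=> x y; rewrite !mxE.
    rewrite -(pick _ a b (fun k => c *: u k a + u k b)); apply: eq_bigr => k _.
    rewrite -(pick _ _ _ (u k)) scaler_sumr; apply: eq_bigr => l _.
    by rewrite !mxE scalerA rmorphD rmorphMn rmorph_nat.
  apply: (ak_proper akJ); first by rewrite -compE; exact: precone_compress.
  have := precone_compress al pNu; congr precone.
  apply/matrixP=> x y; have /matrixP/(_ x y) := compE; rewrite !mxE => <-.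
  rewrite -sumrN; apply: eq_bigr => k _; rewrite -sumrN.
  by apply: eq_bigr => l _; rewrite [(- u) k l]mxE scalerN !mxE.
have diag a : J (u a a).
  have := polar 0 a a; rewrite conjC0 !scale0r !add0r.
  exact.
have cancel x y : J x -> J (x + y) -> J y.
  by move=> Jx /akB/(_ Jx); rewrite addrAC subrr add0r.
(* The diagonal terms of the polarization already lie in [J]. *)
have off (c : R[i]) : J (c^* *: u i j + c *: u j i).
  have := polar c i j; rewrite scalerDr -addrA => /(cancel _ _ (akZ _ (akZ _ (diag i)))).
  by rewrite addrA addrC => /(cancel _ _ (diag j)).
have := off 'i; rewrite conjCi scaleNr => /(akZ 'i).
rewrite scalerDr scalerN !scalerA -expr2 sqrCi !scaleN1r opprK => d.
have := akD (off 1) d; rewrite conjC1 !scale1r addrACA subrr addr0 => s.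
have := akZ 2^-1 s; rewrite scalerDr -scalerDl -[2^-1]mul1r -splitr.
by rewrite scale1r.
Qed.

(** Indexed by the proof so that the quotient type determines [akJ], from which
    its algebraic structures are inferred. *)
Definition ak_pred of archimedean_kernel : U -> bool := fun u => `[< J u >].
Local Notation K := (ak_pred akJ).

Fact ak_predE u : (u \in K) = `[< J u >]. Proof. by []. Qed.

Fact ak_zmod_closed : zmod_closed K.
Proof.
split=> [|u v]; rewrite !ak_predE; first exact/asboolP/ak0.
by move=> /asboolP Ju /asboolP Jv; apply/asboolP/akB.
Qed.

HB.instance Definition _ := GRing.isZmodClosed.Build U K ak_zmod_closed.

Definition ak_quot := Quotient.quot (GRing.ZmodClosed.clone U K _).

HB.instance Definition _ := GRing.Zmodule.on ak_quot.
HB.instance Definition _ := @EqQuotient.on ak_quot.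

Definition ak_map (u : U) : ak_quot := \pi_ak_quot u.

Fact ak_mapP u v : ak_map u = ak_map v <-> J (u - v).
Proof.
split=> [/eqP|Juv].
  by rewrite -Quotient.idealrBE ak_predE => /asboolP.
by apply/eqP; rewrite -Quotient.idealrBE ak_predE; apply/asboolP.
Qed.

Fact ak_map_repr (x : ak_quot) : ak_map (repr x) = x.
Proof. exact: reprK. Qed.

Fact ak_mapD u v : ak_map (u + v) = ak_map u + ak_map v.
Proof. exact: raddfD. Qed.

Definition ak_scale (c : R[i]) (x : ak_quot) : ak_quot := ak_map (c *: repr x).

Fact ak_mapZ c u : ak_map (c *: u) = ak_scale c (ak_map u).
Proof.
by apply/ak_mapP; rewrite -scalerBr; apply/akZ/ak_mapP; rewrite ak_map_repr.
Qed.

Fact ak_scaleA (a b : R[i]) x : ak_scale a (ak_scale b x) = ak_scale (a * b) x.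
Proof. by rewrite -[x]ak_map_repr -!ak_mapZ scalerA. Qed.

Fact ak_scale1 : left_id 1 ak_scale.
Proof. by move=> x; rewrite -[x]ak_map_repr -ak_mapZ scale1r. Qed.

Fact ak_scaleDr : right_distributive ak_scale +%R.
Proof.
move=> c x y; rewrite -[x]ak_map_repr -[y]ak_map_repr.
by rewrite -ak_mapD -!ak_mapZ -ak_mapD scalerDr.
Qed.

Fact ak_scaleDl x : {morph ak_scale^~ x : a b / a + b}.
Proof.
move=> a b; rewrite -[x]ak_map_repr.
by rewrite -!ak_mapZ -ak_mapD scalerDl.
Qed.

HB.instance Definition _ := GRing.Zmodule_isLmodule.Build R[i] ak_quot
  ak_scaleA ak_scale1 ak_scaleDr ak_scaleDl.

Fact ak_map_linear : linear ak_map.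
Proof. by move=> c u v; rewrite ak_mapD ak_mapZ. Qed.

HB.instance Definition _ :=
  GRing.isLinear.Build R[i] U ak_quot _ ak_map ak_map_linear.

Definition ak_quot_star (x : ak_quot) : ak_quot := ak_map (star (repr x)).
Definition ak_quot_pos n : set 'M[ak_quot]_n :=
  [set X | precone (map_mx repr X)].

Fact ak_map_star u : ak_map (star u) = ak_quot_star (ak_map u).
Proof.
apply/ak_mapP; rewrite -starN -starD; apply: ak_star => //.
by apply/ak_mapP; rewrite ak_map_repr.
Qed.

Fact ak_map_surj n (X : 'M[ak_quot]_n) : exists u, X = map_mx ak_map u.
Proof. by exists (map_mx repr X); apply/matrixP=> i j; rewrite !mxE ak_map_repr. Qed.

Fact ak_map_pos n (u : 'M[U]_n) : ak_quot_pos (map_mx ak_map u) <-> precone u.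
Proof.
have Jr v : J (v - repr (ak_map v)) by apply/ak_mapP; rewrite ak_map_repr.
split; apply: precone_eqmod => i j; rewrite !mxE //.
by rewrite -opprB; exact: akN.
Qed.

Fact ak_quot_starK : involutive ak_quot_star.
Proof. by move=> x; rewrite -[x]ak_map_repr -!ak_map_star starK. Qed.

Fact ak_quot_star_semilinear (c : R[i]) (x y : ak_quot) :
  ak_quot_star (c *: x + y) = c^* *: ak_quot_star x + ak_quot_star y.
Proof.
rewrite -[x]ak_map_repr -[y]ak_map_repr -linearP.
by rewrite -!ak_map_star star_semilinear linearP.
Qed.

Fact ak_quot_herm n (X : 'M[ak_quot]_n) :
  ak_quot_pos X -> mxstar ak_quot_star X = X.
Proof.
have [u ->] := ak_map_surj X => /ak_map_pos pu; apply/matrixP=> i j.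
rewrite !mxE -ak_map_star; apply/esym/ak_mapP; exact: precone_herm.
Qed.

Fact ak_quot_pos0 n : ak_quot_pos (0 : 'M[ak_quot]_n).
Proof.
rewrite (_ : 0 = map_mx ak_map 0); first exact/ak_map_pos/precone_pos/pos0.
by apply/matrixP=> i j; rewrite !mxE linear0.
Qed.

Fact ak_quot_posD n (X Y : 'M[ak_quot]_n) :
  ak_quot_pos X -> ak_quot_pos Y -> ak_quot_pos (X + Y).
Proof.
have [[u ->] [v ->]] := (ak_map_surj X, ak_map_surj Y).
move=> /ak_map_pos pu /ak_map_pos pv.
rewrite (_ : _ + _ = map_mx ak_map (u + v)); first exact/ak_map_pos/preconeD.
by apply/matrixP=> i j; rewrite !mxE linearD.
Qed.

Fact ak_quot_posZ n (t : R[i]) (X : 'M[ak_quot]_n) :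
  0 <= t -> ak_quot_pos X -> ak_quot_pos (mxscale t X).
Proof.
have [u ->] := ak_map_surj X => t0 /ak_map_pos pu.
rewrite (_ : mxscale _ _ = map_mx ak_map (mxscale t u)).
  exact/ak_map_pos/preconeZ.
by apply/matrixP=> i j; rewrite !mxE linearZ.
Qed.

Fact ak_quot_pos_proper n (X : 'M[ak_quot]_n) :
  ak_quot_pos X -> ak_quot_pos (- X) -> X = 0.
Proof.
have [u ->] := ak_map_surj X => /ak_map_pos pu.
have -> : - map_mx ak_map u = map_mx ak_map (- u).
  by apply/matrixP=> i j; rewrite !mxE linearN.
move=> /ak_map_pos pNu; apply/matrixP=> i j; rewrite !mxE.
by rewrite -(raddf0 ak_map); apply/ak_mapP; rewrite subr0; exact: precone_proper.
Qed.

Fact ak_quot_pos_compress n m (al : 'M[R[i]]_(n, m)) (X : 'M[ak_quot]_n) :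
  ak_quot_pos X -> ak_quot_pos (mxcompress al X).
Proof.
have [u ->] := ak_map_surj X => /ak_map_pos pu.
rewrite (_ : mxcompress _ _ = map_mx ak_map (mxcompress al u)).
  exact/ak_map_pos/precone_compress.
apply/matrixP=> i j; rewrite !mxE linear_sum; apply: eq_bigr => k _.
by rewrite linear_sum; apply: eq_bigr => l _; rewrite linearZ mxE.
Qed.

Fact ak_map_mxunit n (c : R[i]) (u : 'M[U]_n) :
  mxscale c (mxunit (ak_map opunit) n) + map_mx ak_map u =
  map_mx ak_map (mxscale c (mxunit opunit n) + u).
Proof. by apply/matrixP=> i j; rewrite !mxE linearD linearZ /= (raddfMn ak_map). Qed.

Fact ak_quot_star_unit : ak_quot_star (ak_map opunit) = ak_map opunit.
Proof. by rewrite -ak_map_star star_opunit. Qed.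

Fact ak_quot_order_unit n (X : 'M[ak_quot]_n) :
  mxstar ak_quot_star X = X ->
  exists2 r : R[i], 0 < r &
    ak_quot_pos (mxscale r (mxunit (ak_map opunit) n) + X).
Proof.
have [u ->] := ak_map_surj X => /matrixP hu.
have [i j|r r0 pr] := @precone_order_unit n u.
  by have := hu i j; rewrite !mxE -ak_map_star => /esym/ak_mapP.
by exists r => //; rewrite ak_map_mxunit; apply/ak_map_pos.
Qed.

Fact ak_quot_archimedean n (X : 'M[ak_quot]_n) :
  (forall r : R[i], 0 < r ->
    ak_quot_pos (mxscale r (mxunit (ak_map opunit) n) + X)) ->
  ak_quot_pos X.
Proof.
have [u ->] := ak_map_surj X => h; apply/ak_map_pos/precone_archimedean => r r0.
by apply/ak_map_pos; rewrite -ak_map_mxunit; exact: h.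
Qed.

HB.instance Definition _ := isOperatorSystem.Build R ak_quot
  ak_quot_starK ak_quot_star_semilinear ak_quot_herm ak_quot_pos0
  ak_quot_posD ak_quot_posZ ak_quot_pos_proper ak_quot_pos_compress
  ak_quot_star_unit ak_quot_order_unit ak_quot_archimedean.

Lemma archimedean_kernel_is_kernel : is_kernel J.
Proof.
exists ak_quot, ak_map; split; first split=> //.
  by move=> n u pu; apply/ak_map_pos/precone_pos.
apply/funext => u; apply/propext; rewrite /= -(raddf0 ak_map).
by rewrite ak_mapP subr0.
Qed.

End ArchimedeanQuotient.

(** * The antidiagonal copy of A is a kernel *)
Section Cone1.
Variables (R : realType) (A : cstarAlgType R).

Definition cone1 (V : operatorSystemType R) : set V :=
  [set v | pos (const_mx v : 'M_1)].

Variable V : opASystem A.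
Implicit Types (v w : V).

Lemma cone1D v w : cone1 v -> cone1 w -> cone1 (v + w).
Proof.
by move=> pv /(posD pv); congr pos; apply/matrixP=> i j; rewrite !mxE.
Qed.

Lemma cone1_proper v : cone1 v -> cone1 (- v) -> v = 0.
Proof.
move=> pv pNv; have := pos_proper pv; have -> : - const_mx v = const_mx (- v) :> 'M_1.
  by apply/matrixP=> i j; rewrite !mxE.
by move=> /(_ pNv)/matrixP/(_ 0 0); rewrite !mxE.
Qed.

Lemma cone1_archimedean v :
  (forall r : R, 0 < r -> cone1 (r%:C%C *: opunit + v)) -> cone1 v.
Proof.
move=> h; apply: archimedean => r r0.
have [e re] : exists e : R, r = e%:C%C by apply/complex_realP/gtr0_real.
have := h e; rewrite -ltcR -re => /(_ r0); congr pos.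
by apply/matrixP=> i j; rewrite !mxE !ord1 mulr1n.
Qed.

Lemma cone1_aunit (a : A) : cone1 (aunit V a) <-> pos (amp V (a%:M : 'M_1)).
Proof.
rewrite /cone1 /= (_ : const_mx _ = amp V (a%:M : 'M_1)) //.
by apply/matrixP=> i j; rewrite !mxE !ord1.
Qed.

Lemma aunit_scalar (c : R[i]) : aunit V c%:A = c *: opunit.
Proof. by rewrite linearZ /= aunit1. Qed.

(** Norm convergence in A is order convergence in V: a selfadjoint difference
    of norm at most d lies between -d and d. *)
Lemma cone1_limit v (x : nat -> A) (l : A) (eps : nat -> R) :
  (forall n, cone1 ((eps n)%:C%C *: opunit + v + aunit V (x n))) ->
  (forall n, cstar (x n - l) = x n - l) -> ccvg x l ->
  (forall d : R, 0 < d -> exists N, forall n, (N <= n)%N -> eps n < d) ->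
  cone1 (v + aunit V l).
Proof.
move=> px sx xl eps0; apply: cone1_archimedean => r r0.
have [N hN] := xl (r / 3) ltac:(lra); have [M hM] := eps0 (r / 3) ltac:(lra).
pose n := maxn N M; have := hN n (leq_maxl _ _); have := hM n (leq_maxr _ _) => e1 e2.
have -> : r%:C%C *: opunit + (v + aunit V l) =
    ((eps n)%:C%C *: opunit + v + aunit V (x n)) +
    aunit V ((r - eps n)%:C%C%:A - (x n - l)).
  rewrite linearB /= aunit_scalar rmorphB scalerBl linearB /= opprB.
  rewrite [RHS]addrACA [aunit V (x n) + _]addrC subrK.
  by rewrite [_ + v + _]addrAC [_ *: _ + (_ - _)]addrC subrK addrA.
apply: cone1D => //; apply/cone1_aunit/pos_amp_sq_pos/sq_pos_of_cnorm => //; lra.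
Qed.

End Cone1.

Section AmalgamationKernel.
Variables (R : realType) (A : cstarAlgType R) (S T : opASystem A).
Hypotheses (faithS : faithful S) (faithT : faithful T).

Definition antidiagonal : set (dsum S T) :=
  [set u | exists a : A, u = (lact a opunit, lact (- a) opunit)].

Lemma antidiagonalP (u : dsum S T) :
  antidiagonal u <-> exists a, u = (aunit S a, - aunit T a).
Proof.
by split=> -[a ->]; exists a; rewrite -linearN.
Qed.

Lemma precone_antidiagonalP n (u : 'M[dsum S T]_n) :
  precone antidiagonal u <-> forall r : R[i], 0 < r -> exists a : 'M[A]_n,
    pos (mxscale r (mxunit opunit n) + map_mx fst u + amp S a) /\
    pos (mxscale r (mxunit opunit n) + map_mx snd u - amp T a).
Proof.
have e1 (r : R[i]) (a : 'M[A]_n) (k : 'M[dsum S T]_n) :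
    (forall i j, k i j = (aunit S (a i j), - aunit T (a i j))) ->
    pos (mxscale r (mxunit (opunit : dsum S T) n) + u + k) <->
    pos (mxscale r (mxunit opunit n) + map_mx fst u + amp S a) /\
    pos (mxscale r (mxunit opunit n) + map_mx snd u - amp T a).
  move=> ek.
  have -> : mxscale r (mxunit opunit n) + map_mx fst u + amp S a =
      map_mx fst (mxscale r (mxunit (opunit : dsum S T) n) + u + k).
    by apply/matrixP=> i j; rewrite !mxE ek /=; case: (i == j).
  have -> // : mxscale r (mxunit opunit n) + map_mx snd u - amp T a =
      map_mx snd (mxscale r (mxunit (opunit : dsum S T) n) + u + k).
  by apply/matrixP=> i j; rewrite !mxE ek /=; case: (i == j).
split=> h r /h.
  move=> [k Jk pk].
  have Jk' i j : exists a, k i j = (aunit S a, - aunit T a).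
    exact/antidiagonalP.
  exists (\matrix_(i, j) projT1 (cid (Jk' i j))).
  by apply/(e1 _ _ k) => // i j; rewrite mxE; case: cid.
move=> [a pa]; exists (\matrix_(i, j) (aunit S (a i j), - aunit T (a i j))).
  by move=> i j; rewrite mxE; apply/antidiagonalP; exists (a i j).
by apply/(e1 _ a) => // i j; rewrite mxE.
Qed.

(** Let a_n and b_n be elements of A witnessing, up to 1/(n+1), the positivity of
    (s, t) and of -(s, t).  Adding the inequalities in S bounds a_n + b_m from
    below and adding those in T bounds it from above, so a_n + b_m tends to 0
    in norm as n and m grow.  Hence a_n is Cauchy, b_n tends to the opposite of
    its limit l, and passing to the limit in the four inequalities gives
    s + l = 0 and t - l = 0. *)
Lemma antidiagonal_proper (u : dsum S T) :
  precone antidiagonal (const_mx u : 'M_1) ->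
  precone antidiagonal (const_mx (- u) : 'M_1) -> antidiagonal u.
Proof.
case: u => [s t] /precone_antidiagonalP pu /precone_antidiagonalP pNu.
pose eps n : R := n.+1%:R^-1.
have eps_gt0 n : 0 < eps n by rewrite invr_gt0 ltr0n.
have eps_small (d : R) : 0 < d -> exists N, forall n, (N <= n)%N -> eps n < d.
  move=> d0; exists (Num.bound d^-1) => n Nn.
  rewrite -[d]invrK ltf_pV2 ?posrE ?invr_gt0 ?ltr0n //.
  apply: lt_trans (archi_boundP _) _; first by rewrite invr_ge0 ltW.
  by rewrite ltr_nat.
have ex1 (s' : S) (t' : T) : (forall r : R[i], 0 < r -> exists a : 'M[A]_1,
    pos (mxscale r (mxunit opunit 1) + map_mx fst (const_mx (s', t')) + amp S a) /\
    pos (mxscale r (mxunit opunit 1) + map_mx snd (const_mx (s', t')) - amp T a)) ->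
  exists a : nat -> A, forall n,
    cone1 ((eps n)%:C%C *: opunit + s' + aunit S (a n)) /\
    cone1 ((eps n)%:C%C *: opunit + t' + aunit T (- a n)).
  move=> h; suff /choice[a pa] : forall n, exists a,
      cone1 ((eps n)%:C%C *: opunit + s' + aunit S a) /\
      cone1 ((eps n)%:C%C *: opunit + t' + aunit T (- a)) by exists a.
  move=> n; have [|a [p1 p2]] := h (eps n)%:C%C; first by rewrite ltcR.
  exists (a 0 0); split; [move: p1 | move: p2]; congr pos; apply/matrixP=> i j;
    by rewrite !mxE !ord1 mulr1n ?linearN.
have [a pa] := ex1 _ _ pu; have [b pb] := ex1 _ _ pNu.
have comb (V : opASystem A) (v : V) (x y : A) (e f : R) :
    cone1 (e%:C%C *: opunit + v + aunit V x) ->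
    cone1 (f%:C%C *: opunit - v + aunit V y) ->
    cone1 (aunit V ((e + f)%:C%C%:A + (x + y))).
  move=> p1 p2; have := cone1D p1 p2; congr cone1.
  rewrite linearD /= aunit_scalar linearD /= rmorphD scalerDl addrACA.
  by congr (_ + _); rewrite addrACA subrr addr0.
have sab n m : [/\ sq_pos ((eps n + eps m)%:C%C%:A + (a n + b m)) &
    sq_pos ((eps n + eps m)%:C%C%:A - (a n + b m))].
  split.
    by apply: (sq_pos_of_pos_amp faithS); apply/cone1_aunit/comb;
      [exact: (pa n).1 | exact: (pb m).1].
  rewrite opprD; apply: (sq_pos_of_pos_amp faithT); apply/cone1_aunit/comb.
    exact: (pa n).2.
  exact: (pb m).2.
have nab n m : cnorm (a n + b m) <= eps n + eps m.
  have [p1 p2] := sab n m; apply: cnorm_of_sq_pos => //.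
  by have := eps_gt0 n; have := eps_gt0 m; lra.
have saab n m : cstar (a n + b m) = a n + b m.
  have [/sq_pos_sa + _] := sab n m.
  by rewrite [X in X = _ -> _]cstarD cstarZr cstar1 => /addrI.
have aa n m k : a n - a m = (a n + b k) - (a m + b k).
  by rewrite opprD addrACA subrr addr0.
have saa n m : cstar (a n - a m) = a n - a m.
  by rewrite (aa _ _ 0%N) cstarB !saab.
(* [a n + b k] and [a m + b k] are both small, so [a] is Cauchy. *)
have [l al] : exists l, ccvg a l.
  apply: cnorm_complete => e e0; have [N hN] := eps_small (e / 4) ltac:(lra).
  exists N => m n mN nN; rewrite (aa _ _ n).
  have := cnormB (a m + b n) (a n + b n); have := nab m n; have := nab n n.
  by have := hN m mN; have := hN n nN; lra.
have sal n : cstar (a n - l) = a n - l.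
  apply: (@ccvg_sa _ _ (fun m => a n - a m)) => //.
  apply: (@ccvg_dominated _ _ 1 a _ l) al => m.
  by rewrite opprB addrC addrA subrK mul1r -cnormN opprB.
have sbl n : cstar (b n - - l) = b n - - l.
  have -> : b n - - l = (a n + b n) - (a n - l).
    by rewrite opprK opprB [a n + b n]addrC addrACA subrr addr0.
  by rewrite cstarB saab sal.
have bl : ccvg b (- l).
  move=> e e0; have [N hN] := eps_small (e / 4) ltac:(lra).
  have [M hM] := al (e / 4) ltac:(lra); exists (maxn N M) => n.
  rewrite geq_max => /andP[nN nM].
  have -> : b n - - l = (a n + b n) - (a n - l).
    by rewrite opprK opprB [a n + b n]addrC addrACA subrr addr0.
  have := cnormB (a n + b n) (a n - l); have := nab n n.
  by have := hN n nN; have := hM n nM; lra.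
have ccvgN x y : ccvg x y -> ccvg (fun n => - x n) (- y :> A).
  by apply: (@ccvg_dominated _ _ 1) => n; rewrite -opprD cnormN mul1r.
have es : s = - aunit S l.
  apply/eqP; rewrite -subr_eq0 opprK; apply/eqP/cone1_proper.
    by apply: cone1_limit al eps_small => // n; exact: (pa n).1.
  rewrite opprD -linearN.
  by apply: cone1_limit bl eps_small => // n; exact: (pb n).1.
have et : t = aunit T l.
  apply/eqP; rewrite -subr_eq0 -linearN; apply/eqP/cone1_proper.
    apply: (@cone1_limit _ _ _ _ (fun n => - a n) _ eps) => //.
    - by move=> n; exact: (pa n).2.
    - by move=> n; rewrite -opprD cstarN sal.
    - exact: ccvgN.
  rewrite opprD -linearN.
  apply: (@cone1_limit _ _ _ _ (fun n => - b n) _ eps) => //.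
  - by move=> n; exact: (pb n).2.
  - by move=> n; rewrite -opprD cstarN sbl.
  - exact: ccvgN.
by apply/antidiagonalP; exists (- l); rewrite !linearN opprK es et.
Qed.

Lemma antidiagonal_archimedean_kernel : archimedean_kernel antidiagonal.
Proof.
split.
- by apply/antidiagonalP; exists 0; rewrite (linear0 (aunit S)) (linear0 (aunit T)) oppr0.
- move=> c u v /antidiagonalP[a ->] /antidiagonalP[b ->].
  apply/antidiagonalP; exists (c *: a + b); rewrite !linearP.
  by congr pair; rewrite opprD -scalerN.
- move=> u /antidiagonalP[a ->]; apply/antidiagonalP; exists (cstar a).
  by rewrite -!star_aunit; congr pair; exact: starN.
- exact: antidiagonal_proper.
Qed.

Lemma antidiagonal_is_kernel : is_kernel antidiagonal.
Proof. exact: archimedean_kernel_is_kernel antidiagonal_archimedean_kernel. Qed.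

End AmalgamationKernel.

(** * The action of A on a quotient *)
Section QuotientAction.
Variables (R : realType) (A : cstarAlgType R) (U : opASystem A) (J : set U).
Hypothesis kerJ : is_kernel J.
Hypothesis J_lact : forall a u, J u -> J (lact a u).
Hypothesis J_ract : forall a u, J u -> J (ract u a).
Local Notation q := (quotient_map kerJ).

Lemma quotient_map_eqP u v : q u = q v <-> J (u - v).
Proof.
by split=> [/quotient_mapP/asboolP|Juv] //; apply/quotient_mapP/asboolP.
Qed.

Lemma pos_quotient_map n (u : 'M[U]_n) :
  pos (map_mx q u : 'M[quotient kerJ]_n) <-> precone J u.
Proof.
rewrite -[pos _]/(quotient_pos _) quotient_posP; split=> h r r0.
  have [w ew pw] := h r r0.
  exists (w - (mxscale r (mxunit opunit n) + u)) => [i j|]; last first.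
    by rewrite addrC subrK.
  move/matrixP: ew => /(_ i j).
  rewrite mxunit_quotient mxscale_quotient mxadd_quotient mxE [RHS]mxE => e.
  by rewrite !mxE; apply/quotient_map_eqP; rewrite -e !mxE.
have [k Jk pk] := h r r0; exists (mxscale r (mxunit opunit n) + u + k) => //.
rewrite mxunit_quotient mxscale_quotient mxadd_quotient.
apply/matrixP=> i j; rewrite mxE [RHS]mxE; apply/esym/quotient_map_eqP.
by rewrite [X in X - _]mxE addrAC subrr add0r.
Qed.

Definition quotient_lact (a : A) (x : quotient kerJ) : quotient kerJ :=
  q (lact a (repr x)).
Definition quotient_ract (x : quotient kerJ) (a : A) : quotient kerJ :=
  q (ract (repr x) a).

Lemma quotient_map_lact a u : q (lact a u) = quotient_lact a (q u).
Proof.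
apply/quotient_map_eqP; rewrite -lactB; apply: J_lact.
by apply/quotient_map_eqP; rewrite quotient_map_repr.
Qed.

Lemma quotient_map_ract a u : q (ract u a) = quotient_ract (q u) a.
Proof.
apply/quotient_map_eqP; rewrite -ractB; apply: J_ract.
by apply/quotient_map_eqP; rewrite quotient_map_repr.
Qed.

Lemma mxact_quotient m n (a : 'M[A]_(m, n)) (u : 'M[U]_n) :
  mxact quotient_lact quotient_ract a (map_mx q u) =
  map_mx q (mxact (@lact _ _ U) (@ract _ _ U) a u).
Proof.
apply/matrixP=> i j; rewrite !mxE linear_sum; apply: eq_bigr => k _.
rewrite linear_sum; apply: eq_bigr => l _.
by rewrite mxE /= quotient_map_ract quotient_map_lact.
Qed.

Lemma precone_mxact m n (a : 'M[A]_(m, n)) (u : 'M[U]_n) :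
  precone J u -> precone J (mxact (@lact _ _ U) (@ract _ _ U) a u).
Proof.
move=> pu r r0; pose act := mxact (@lact _ _ U) (@ract _ _ U) a.
have pE : pos (act (mxunit opunit n)) by exact/pos_mxact/pos_mxunit.
have [d d0 absorb] := unit_absorbs_pos pE r0; have [k Jk pk] := pu _ d0.
have JP v : J v <-> q v = 0.
  by rewrite -(linear0 q) quotient_map_eqP subr0.
exists (act k) => [i j|].
  rewrite mxE; apply/JP; rewrite linear_sum big1 // => h _.
  by rewrite linear_sum big1 // => l _; apply/JP/J_ract/J_lact.
rewrite -addrA; apply: absorb; rewrite addrA.
have := pos_mxact (opA_action U) a pk.
by rewrite -[mxact (left_act _) _]/(mxact (@lact _ _ U) (@ract _ _ U)) !mxactD mxactZ.
Qed.

Definition quotient_action : opActionOn A (quotient kerJ).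
Proof.
apply: (@OpActionOn R A (quotient kerJ) quotient_lact quotient_ract).
- by move=> x c a b; rewrite /quotient_lact [lact _ _]left_act_linearl linearP.
- move=> a c x y; rewrite -[x]quotient_map_repr -[y]quotient_map_repr -linearP.
  by rewrite -!quotient_map_lact lactP linearP.
- move=> a c x y; rewrite -[x]quotient_map_repr -[y]quotient_map_repr -linearP.
  by rewrite -!quotient_map_ract ractP linearP.
- by move=> x c a b; rewrite /quotient_ract [ract _ _]right_act_linearr linearP.
- by move=> x; rewrite /quotient_lact [lact _ _]left_act1 quotient_map_repr.
- by move=> x; rewrite /quotient_ract [ract _ _]right_act1 quotient_map_repr.
- move=> a b x; rewrite -[x]quotient_map_repr -!quotient_map_lact.
  by rewrite [lact (a * b) _]left_actM.
- move=> x a b; rewrite -[x]quotient_map_repr -!quotient_map_ract.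
  by rewrite [ract _ (a * b)]right_actM.
- move=> a x b; rewrite -[x]quotient_map_repr -quotient_map_lact.
  rewrite -!quotient_map_ract -quotient_map_lact.
  by rewrite [ract _ _]left_right_act.
- move=> a x; rewrite -[x]quotient_map_repr -quotient_map_lact.
  rewrite -![star (q _)]quotient_map_star -quotient_map_ract.
  by rewrite [star (lact _ _)]left_act_star.
- move=> a; rewrite -[opunit]/(q opunit) -quotient_map_lact -quotient_map_ract.
  by rewrite [lact _ _]left_right_unit.
- move=> m n a X; have [u ->] := map_quotient_surj X.
  by move=> /pos_quotient_map/precone_mxact pu; rewrite mxact_quotient; apply/pos_quotient_map.
Defined.

End QuotientAction.

(** * Uniqueness of coproducts *)
Section Universality.
Variables (R : realType) (A : cstarAlgType R).

Lemma coproduct_unique (S T P Q : opASystem A)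
    (iS : {linear S -> P}) (iT : {linear T -> P})
    (jS : {linear S -> Q}) (jT : {linear T -> Q}) :
  is_coproduct iS iT -> is_coproduct jS jT ->
  exists phi : {linear Q -> P},
    [/\ unital phi, complete_order_iso phi & bimodule_map phi].
Proof.
move=> [_ [uiS [_ piS] biS] [uiT [_ piT] biT] univP].
move=> [_ [ujS [_ pjS] bjS] [ujT [_ pjT] bjT] univQ].
have cp (V W : operatorSystemType R) (f : {linear V -> W}) : unital f ->
    (forall n (X : 'M_n), pos X <-> pos (map_mx f X)) -> ucp f.
  by move=> uf pf; split=> // n X; apply (proj1 (pf n X)).
have ucpid (V : opASystem A) : ucp (@idfun V : {linear V -> V}).
  by split=> // n X; congr pos; apply/matrixP=> i j; rewrite mxE.
have [phi [[[uphi cphi] bphi phiS phiT] _]] :=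
  univQ P iS iT (cp _ _ _ uiS piS) biS (cp _ _ _ uiT piT) biT.
have [psi [[[upsi cpsi] bpsi psiS psiT] _]] :=
  univP Q jS jT (cp _ _ _ ujS pjS) bjS (cp _ _ _ ujT pjT) bjT.
have comp_ucp (V W X : opASystem A) (f : {linear V -> W}) (g : {linear W -> X}) :
    ucp f -> ucp g -> ucp (g \o f : {linear V -> X}).
  move=> [uf cf] [ug cg]; split; first by rewrite /unital /= uf ug.
  move=> n Y pY; rewrite map_mx_comp; exact/cg/cf.
exists phi; split=> //; split=> //; exists psi; split=> // x.
  have [chi [_ uniq]] := univQ Q jS jT (cp _ _ _ ujS pjS) bjS (cp _ _ _ ujT pjT) bjT.
  have e1 : psi \o phi =1 chi.
    apply: (uniq (psi \o phi : {linear Q -> Q})); split; first exact: comp_ucp.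
    + by move=> a b s; rewrite /= bphi bpsi.
    + by move=> s; rewrite /= phiS.
    + by move=> s; rewrite /= phiT.
  have e2 : idfun =1 chi by apply: (uniq (@idfun Q : {linear Q -> Q})).
  by rewrite -[LHS]/((psi \o phi) x) e1 -e2.
have [chi [_ uniq]] := univP P iS iT (cp _ _ _ uiS piS) biS (cp _ _ _ uiT piT) biT.
have e1 : phi \o psi =1 chi.
  apply: (uniq (phi \o psi : {linear P -> P})); split; first exact: comp_ucp.
  + by move=> a b s; rewrite /= bpsi bphi.
  + by move=> s; rewrite /= psiS.
  + by move=> s; rewrite /= psiT.
have e2 : idfun =1 chi by apply: (uniq (@idfun P : {linear P -> P})).
by rewrite -[LHS]/((phi \o psi) x) e1 -e2.
Qed.

End Universality.

(** * The quotient is the coproduct *)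
Section Amalgam.
Variables (R : realType) (A : cstarAlgType R) (S T : opASystem A).
Hypotheses (faithS : faithful S) (faithT : faithful T).
Local Notation ST := (dsum S T).
Local Notation J := (@antidiagonal _ _ S T).

Lemma antidiagonal_lact a (u : ST) : J u -> J (lact a u).
Proof.
move=> /antidiagonalP[b ->]; apply/antidiagonalP; exists (a * b).
congr pair; first exact: lact_aunit.
by rewrite -!linearN -mulrN; exact: lact_aunit.
Qed.

Lemma antidiagonal_ract a (u : ST) : J u -> J (ract u a).
Proof.
move=> /antidiagonalP[b ->]; apply/antidiagonalP; exists (b * a).
congr pair; first exact: ract_aunit.
by rewrite -!linearN -mulNr; exact: ract_aunit.
Qed.

Variable kerJ : is_kernel J.

Definition amalgam_action : opActionOn A (quotient kerJ) :=
  quotient_action kerJ antidiagonal_lact antidiagonal_ract.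
Definition amalgam : opASystem A := OpASystem amalgam_action.
Definition amalgam_map : {linear ST -> amalgam} := quotient_map kerJ.
Local Notation Q := amalgam.
Local Notation q := amalgam_map.

Lemma amalgam_map_bimodule : bimodule_map q.
Proof.
move=> a b s; rewrite [LHS]quotient_map_ract; last first.
  exact: antidiagonal_ract.
by congr quotient_ract; apply: quotient_map_lact; exact: antidiagonal_lact.
Qed.

Lemma amalgam_map_eq u v : q u = q v <-> J (u - v).
Proof. exact: quotient_map_eqP. Qed.

Lemma amalgam_map_ucp : ucp q.
Proof. by split=> // n X; exact: quotient_posW. Qed.

(** The factor 2 makes the map unital: (2 e_S, 0) and (e_S, e_T) differ by an
    element of the antidiagonal. *)
Definition amalgam_inl (s : S) : Q := q ((2 : R[i]) *: s, 0).
Definition amalgam_inr (t : T) : Q := q (0, (2 : R[i]) *: t).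

Fact amalgam_inl_linear : linear amalgam_inl.
Proof.
move=> c x y; rewrite /amalgam_inl -linearP; congr (q (_, _)).
  by rewrite /= scalerDr !scalerA [c * _]mulrC.
by rewrite /= scaler0 addr0.
Qed.

Fact amalgam_inr_linear : linear amalgam_inr.
Proof.
move=> c x y; rewrite /amalgam_inr -linearP; congr (q (_, _)).
  by rewrite /= scaler0 addr0.
by rewrite /= scalerDr !scalerA [c * _]mulrC.
Qed.

HB.instance Definition _ :=
  GRing.isLinear.Build R[i] S Q _ amalgam_inl amalgam_inl_linear.
HB.instance Definition _ :=
  GRing.isLinear.Build R[i] T Q _ amalgam_inr amalgam_inr_linear.

Let two (V : lmodType R[i]) (v : V) : (2 : R[i]) *: v = v + v.
Proof. by rewrite scaler_nat. Qed.

Lemma amalgam_faithful : faithful Q.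
Proof.
move=> a a0; rewrite -[opunit]/(q opunit).
have -> : lact a (q opunit) = q (lact a opunit).
  by apply/esym; apply: quotient_map_lact; exact: antidiagonal_lact.
rewrite -(linear0 q) => /amalgam_map_eq; rewrite subr0 => /antidiagonalP[b []].
move=> /(aunit_inj faithS) ab; rewrite -linearN => /(aunit_inj faithT).
rewrite -ab => e; apply: a0; apply/eqP; move/eqP: e.
by rewrite -subr_eq0 opprK -two scaler_eq0 pnatr_eq0.
Qed.

Lemma amalgam_inl_unital : unital (amalgam_inl : {linear S -> Q}).
Proof.
apply/amalgam_map_eq/antidiagonalP; exists 1; rewrite !aunit1; congr pair.
  by rewrite /= two addrK.
by rewrite /= add0r.
Qed.

Lemma amalgam_inr_unital : unital (amalgam_inr : {linear T -> Q}).
Proof.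
apply/amalgam_map_eq/antidiagonalP; exists (- 1); rewrite (linearN (aunit S)) (linearN (aunit T)) /= !aunit1.
congr pair; first by rewrite /= add0r.
by rewrite /= two addrK opprK.
Qed.

Let half_pos (V : opASystem A) n (X : 'M[V]_n) :
  (forall r : R[i], 0 < r ->
     pos (mxscale (r + r) (mxunit opunit n) + mxscale 2 X)) ->
  pos X.
Proof.
move=> h; apply: archimedean => r r0.
have := posZ (_ : 0 <= 2^-1 :> R[i]) (h r r0); rewrite invr_ge0 ler0n => /(_ isT).
congr pos; apply/matrixP=> i j; rewrite !mxE scalerDr !scalerA mulVf ?pnatr_eq0 //.
by rewrite scale1r -[r + r]mulr2n -[r *+ 2]mulr_natl mulrA mulVf ?pnatr_eq0 ?mul1r.
Qed.

(** The reason why nothing new becomes positive in the quotient: the bound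
    r - a >= 0 transfers from W to V and is added to the first inequality. *)
Let pos_absorb (V W : opASystem A) n (r : R[i]) (Y : 'M[V]_n) (a : 'M[A]_n) :
  faithful W -> pos (mxscale r (mxunit opunit n) + Y + amp V a) ->
  pos (mxscale r (mxunit opunit n) - amp W a) ->
  pos (mxscale (r + r) (mxunit opunit n) + Y).
Proof.
move=> faithW p1; rewrite -amp_unit -ampN -ampD => /(pos_amp_transfer V faithW).
rewrite ampD ampN amp_unit => /(posD p1); congr pos.
by apply/matrixP=> i j; rewrite !mxE addrACA subrr addr0 addrAC -scalerDl.
Qed.

Let two_inj (V : lmodType R[i]) : injective ( *:%R (2 : R[i]) : V -> V).
Proof. by apply: scalerI; rewrite pnatr_eq0. Qed.

Let pos_two (V : operatorSystemType R) n (X : 'M[V]_n) : pos X -> pos (mxscale 2 X).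
Proof. by move=> pX; apply: posZ pX; exact: ler0n. Qed.

Lemma amalgam_inl_embedding :
  complete_order_embedding (amalgam_inl : {linear S -> Q}).
Proof.
split=> [x y /amalgam_map_eq /antidiagonalP[a []]|n X].
  rewrite subr0 => e /esym/eqP; rewrite oppr_eq0 => /eqP a0.
  have {}a0 : a = 0 by apply: (aunit_inj faithT); rewrite a0 linear0.
  by apply: two_inj; apply/eqP; rewrite -subr_eq0 e a0 linear0.
pose u : 'M[ST]_n := \matrix_(i, j) ((2 : R[i]) *: X i j, 0).
have u1 : map_mx fst u = mxscale 2 X by apply/matrixP=> i j; rewrite !mxE.
have u2 : map_mx snd u = 0 :> 'M[T]_n by apply/matrixP=> i j; rewrite !mxE.
have -> : map_mx amalgam_inl X = map_mx q u by apply/matrixP=> i j; rewrite !mxE.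
split=> [pX|/(pos_quotient_map kerJ)/precone_antidiagonalP pu].
  by apply: amalgam_map_ucp.2; split; rewrite ?u1 ?u2; [exact: pos_two | exact: pos0].
apply: half_pos => r r0; have [a] := pu r r0; rewrite u1 u2 addr0 => -[p1 p2].
exact: pos_absorb faithT p1 p2.
Qed.

Lemma amalgam_inr_embedding :
  complete_order_embedding (amalgam_inr : {linear T -> Q}).
Proof.
split=> [x y /amalgam_map_eq /antidiagonalP[a [/esym]]|n X].
  rewrite subr0 => a0 e.
  have {}a0 : a = 0 by apply: (aunit_inj faithS); rewrite a0 linear0.
  by apply: two_inj; apply/eqP; rewrite -subr_eq0 e a0 linear0 oppr0.
pose u : 'M[ST]_n := \matrix_(i, j) (0, (2 : R[i]) *: X i j).
have u1 : map_mx fst u = 0 :> 'M[S]_n by apply/matrixP=> i j; rewrite !mxE.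
have u2 : map_mx snd u = mxscale 2 X by apply/matrixP=> i j; rewrite !mxE.
have -> : map_mx amalgam_inr X = map_mx q u by apply/matrixP=> i j; rewrite !mxE.
split=> [pX|/(pos_quotient_map kerJ)/precone_antidiagonalP pu].
  by apply: amalgam_map_ucp.2; split; rewrite ?u1 ?u2; [exact: pos0 | exact: pos_two].
apply: half_pos => r r0; have [a] := pu r r0; rewrite u1 u2 addr0 => -[p1 p2].
by apply: (pos_absorb (a := - a) faithS); rewrite ampN ?opprK.
Qed.

Lemma amalgam_inl_bimodule : bimodule_map (amalgam_inl : {linear S -> Q}).
Proof.
move=> a b s; apply: etrans (amalgam_map_bimodule a b (2 *: s, 0)).
by congr (q (_, _)); rewrite /= ?lactZ ?ractZ ?lact0 ?ract0.
Qed.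

Lemma amalgam_inr_bimodule : bimodule_map (amalgam_inr : {linear T -> Q}).
Proof.
move=> a b t; apply: etrans (amalgam_map_bimodule a b (0, 2 *: t)).
by congr (q (_, _)); rewrite /= ?lactZ ?ractZ ?lact0 ?ract0.
Qed.

Lemma amalgam_map_split (s : S) (t : T) :
  q (s, t) = (2^-1 : R[i]) *: (amalgam_inl s + amalgam_inr t).
Proof.
rewrite /amalgam_inl /amalgam_inr -linearD -linearZ; congr (q (_, _)) => /=.
  by rewrite addr0 scalerA mulVf ?pnatr_eq0 // scale1r.
by rewrite add0r scalerA mulVf ?pnatr_eq0 // scale1r.
Qed.

Lemma amalgam_map_surj (x : Q) : exists u, x = q u.
Proof. by exists (repr (x : quotient kerJ)); rewrite [RHS]quotient_map_repr. Qed.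

Lemma bimodule_aunit (V W : opASystem A) (f : {linear V -> W}) (a : A) :
  unital f -> bimodule_map f -> f (aunit V a) = aunit W a.
Proof.
move=> uf bf; have := bf a 1 opunit; rewrite uf.
by rewrite [ract (lact a (opunit : V)) 1]right_act1 [ract _ 1]right_act1.
Qed.

Section Extension.
Variables (Z : opASystem A) (psi1 : {linear S -> Z}) (psi2 : {linear T -> Z}).
Hypotheses (ucp1 : ucp psi1) (bi1 : bimodule_map psi1).
Hypotheses (ucp2 : ucp psi2) (bi2 : bimodule_map psi2).

(** The half sum, rather than the sum, compensates the factor 2 in the
    embeddings. *)
Definition half_sum (u : ST) : Z := (2^-1 : R[i]) *: (psi1 u.1 + psi2 u.2).

Fact half_sum_linear : linear half_sum.
Proof.
move=> c u v; rewrite /half_sum (linearP psi1) (linearP psi2) /= addrACA scalerDr.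
by rewrite [in RHS]scalerA [c * _]mulrC -[in RHS]scalerA [c *: (_ + _)]scalerDr.
Qed.

HB.instance Definition _ := GRing.isLinear.Build R[i] ST Z _ half_sum half_sum_linear.

Definition extension_fun (x : Q) : Z := half_sum (repr (x : quotient kerJ)).

Lemma extension_funE u : extension_fun (q u) = half_sum u.
Proof.
apply/eqP; rewrite -subr_eq0 -linearB /=; apply/eqP.
set v := (_ - _); have /antidiagonalP[a ->] : J v.
  by apply/amalgam_map_eq; exact: quotient_map_repr.
rewrite /half_sum /= linearN /= (bimodule_aunit _ ucp1.1 bi1).
by rewrite (bimodule_aunit _ ucp2.1 bi2) subrr scaler0.
Qed.

Fact extension_fun_linear : linear extension_fun.
Proof.
move=> c x y; have [[u ->] [v ->]] := (amalgam_map_surj x, amalgam_map_surj y).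
by rewrite -linearP !extension_funE linearP.
Qed.

HB.instance Definition _ :=
  GRing.isLinear.Build R[i] Q Z _ extension_fun extension_fun_linear.

Definition amalgam_extension : {linear Q -> Z} := extension_fun.

Lemma amalgam_extensionE u : amalgam_extension (q u) = half_sum u.
Proof. exact: extension_funE. Qed.

Lemma amalgam_extension_ucp : ucp amalgam_extension.
Proof.
have avg1 : half_sum opunit = opunit.
  by rewrite /half_sum /= ucp1.1 ucp2.1 -two scalerA mulVf ?pnatr_eq0 // scale1r.
split=> [|n X]; first by apply: etrans avg1; exact: (amalgam_extensionE opunit).
have [u ->] := map_quotient_surj (X : 'M[quotient kerJ]_n).
have -> : map_mx amalgam_extension (map_mx (quotient_map kerJ) u) = map_mx half_sum u.
  by apply/matrixP=> i j; rewrite mxE [RHS]mxE mxE; exact: amalgam_extensionE.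
move=> /(pos_quotient_map kerJ)/precone_antidiagonalP pu; apply: archimedean => r r0.
have [a [/ucp1.2 p1 /ucp2.2 p2]] := pu r r0.
have := posZ (_ : 0 <= 2^-1 :> R[i]) (posD p1 p2); rewrite invr_ge0 ler0n => /(_ isT).
congr pos; apply/matrixP=> i j; rewrite !mxE /half_sum.
rewrite !(linearD psi1) !(linearD psi2) (linearN psi2) /= (bimodule_aunit _ ucp1.1 bi1) (bimodule_aunit _ ucp2.1 bi2).
rewrite [psi1 (_ *: _)]linearZ [psi2 (_ *: _)]linearZ /= (raddfMn psi1) (raddfMn psi2) /=.
rewrite ucp1.1 ucp2.1 addrACA subrr addr0 addrACA scalerDr; congr (_ + _).
by rewrite -two scalerA mulVf ?pnatr_eq0 // scale1r.
Qed.

Lemma amalgam_extension_bimodule :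
  bimodule_map amalgam_extension.
Proof.
move=> a b x; have [u ->] := amalgam_map_surj x.
rewrite -amalgam_map_bimodule !amalgam_extensionE /half_sum /= bi1 bi2.
by rewrite lactZ ractZ lactD ractD.
Qed.

End Extension.

Lemma amalgam_is_coproduct :
  is_coproduct (amalgam_inl : {linear S -> Q}) (amalgam_inr : {linear T -> Q}).
Proof.
split.
- exact: amalgam_faithful.
- split; [exact: amalgam_inl_unital | exact: amalgam_inl_embedding
    | exact: amalgam_inl_bimodule].
- split; [exact: amalgam_inr_unital | exact: amalgam_inr_embedding
    | exact: amalgam_inr_bimodule].
move=> Z psi1 psi2 u1 b1 u2 b2; exists (amalgam_extension u1 b1 u2 b2); split.
  split; [exact: amalgam_extension_ucp | exact: amalgam_extension_bimodule | |].
    move=> s; rewrite [LHS]amalgam_extensionE /half_sum /= linear0 addr0 linearZ.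
    by rewrite scalerA mulVf ?pnatr_eq0 // scale1r.
  move=> t; rewrite [LHS]amalgam_extensionE /half_sum /= linear0 add0r linearZ.
  by rewrite scalerA mulVf ?pnatr_eq0 // scale1r.
move=> Psi [_ _ P1 P2] x; have [[s t] ->] := amalgam_map_surj x.
rewrite amalgam_map_split linearZ linearD /= P1 P2.
by rewrite -amalgam_map_split amalgam_extensionE.
Qed.

End Amalgam.

Theorem theorem3p7 (R : realType) (A : cstarAlgType R) (S T : opASystem A)
    (faithS : faithful S) (faithT : faithful T) :
  let J : set (dsum S T) :=
    [set u | exists a : A, u = (lact a opunit, lact (- a) opunit)] in
  exists (kerJ : is_kernel J) (act : opActionOn A (quotient kerJ)),
    let Q : opASystem A := OpASystem act in
    let q : {linear dsum S T -> Q} := quotient_map kerJ in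
    [/\ exists (P : opASystem A) (iS : {linear S -> P}) (iT : {linear T -> P}),
          is_coproduct iS iT,
        forall (P : opASystem A) (iS : {linear S -> P}) (iT : {linear T -> P}),
          is_coproduct iS iT ->
          exists phi : {linear Q -> P},
            [/\ unital phi, complete_order_iso phi & bimodule_map phi]
      & ucp q /\ bimodule_map q].
Proof.
move=> J; have kerJ : is_kernel J := antidiagonal_is_kernel faithS faithT.
have cop := amalgam_is_coproduct faithS faithT kerJ.
exists kerJ, (amalgam_action kerJ) => Q q; split.
- by exists Q, (amalgam_inl kerJ), (amalgam_inr kerJ).
- by move=> P iS iT /coproduct_unique; apply; exact: cop.
by split; [exact: amalgam_map_ucp | exact: amalgam_map_bimodule].
Qed.
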